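(* Let $U\subset\mathbb R^m$ be open and $k\in\mathbb N\cup\{\infty\}$. The following hold for internal maps into ${}^*\mathbb R^n$. (1) If $\mathfrak f\in SC^k(U,\mathbb R^n)$, then the standard part ${}^\circ\mathfrak f$ exists and is in $C^k(U,\mathbb R^n)$. Furthermore, if $\alpha$ is a (standard) finite multi-index with $|\alpha|\le k$, then ${}^\circ({}^*\partial^\alpha\mathfrak f)=\partial^\alpha({}^\circ\mathfrak f)$ on $U$. (2) If $\mathfrak f,\mathfrak g\in SC^k(U,\mathbb R^n)$ and $\mathfrak f(\xi)\sim\mathfrak g(\xi)$ for all $\xi\in{}^*U_{nes}$, then ${}^*\partial^\alpha\mathfrak f(\xi)\sim{}^*\partial^\alpha\mathfrak g(\xi)$ for all (standard) finite multi-indices $\alpha$ with $|\alpha|\le k$ and all $\xi\in{}^*U_{nes}$. (3) If $\mathfrak f\in SC^k(U,\mathbb R^n)$, then ${}^*\partial^\alpha\mathfrak f(\xi)\sim{}^*\partial^\alpha({}^*({}^\circ\mathfrak f))(\xi)$ for all $\alpha$ with $|\alpha|\le k$ and all $\xi\in{}^*U_{nes}$.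
   Context: Work in a sufficiently saturated nonstandard extension ${}^*$ of a superstructure over $\mathbb R$. $a\sim b$ means $|a-b|$ is infinitesimal. ${}^*U_{nes}$ is the set of $\xi\in{}^*U$ with $\xi\sim{}^*x$ for some $x\in U$. A point of ${}^*\mathbb R^n$ is nearstandard if it is infinitesimally close to a standard point; ${}^\circ$ denotes the standard part, and for an internal map $\mathfrak f$, ${}^\circ\mathfrak f(x)={}^\circ(\mathfrak f({}^*x))$ for $x\in U$. An internal map $\mathfrak f$ is $SC^0$ ($S$-continuous) if it maps ${}^*U_{nes}$ to nearstandard points and $\xi\sim\zeta$ in ${}^*U_{nes}$ implies $\mathfrak f(\xi)\sim\mathfrak f(\zeta)$. $SC^k(U,\mathbb R^n)$ is the set of internal maps $\mathfrak f$ that are ${}^*C^k$ (internally $C^k$) and such that for every (standard) finite multi-index $\alpha$ with $|\alpha|\le k$ (including $\alpha=0$) the internal partial derivative ${}^*\partial^\alpha\mathfrak f$ is $SC^0$. *)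

(* Defs.v *)
From HB Require Import structures.
From mathcomp Require Import all_boot all_order all_algebra.
From mathcomp Require Import all_classical all_reals all_analysis.

Set Implicit Arguments.
Unset Strict Implicit.
Unset Printing Implicit Defensive.

Import Order.TTheory GRing.Theory Num.Theory.
Import numFieldNormedType.Exports.

Local Open Scope classical_set_scope.
Local Open Scope ring_scope.

(* V_0 = X, V_(n+1) = V_n `|` P(V_n); the elements of X are urelements. *)
Fixpoint level (X T : Type) (atom : X -> T) (elem : T -> T -> Prop) (n : nat)
    : set T :=
  if n is n'.+1 then
    level atom elem n' `|`
    [set a | ~ range atom a /\ [set c | elem c a] `<=` level atom elem n']
  else range atom.

(* The superstructure over X, up to isomorphism: these fields determine the
   membership structure on the union of the V_n over the urelements X. The
   value of [setof P] is unspecified when P is not a subset of some V_n. *)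
Record superstructure (X : Type) := Superstructure {
  elt :> Type;
  atom : X -> elt;
  elem : elt -> elt -> Prop;
  setof : set elt -> elt;
  atom_inj : forall x y, atom x = atom y -> x = y;
  elem_atom : forall x c, ~ elem c (atom x);
  set_ext : forall a b, ~ range atom a -> ~ range atom b ->
    (forall c, elem c a <-> elem c b) -> a = b;
  finite_rank : forall a, exists n, level atom elem n a;
  setof_not_atom : forall n P, P `<=` level atom elem n ->
    ~ range atom (setof P);
  elem_setof : forall n P, P `<=` level atom elem n ->
    forall c, elem c (setof P) <-> P c }.

Arguments atom {X s}.
Arguments elem {X s}.
Arguments setof {X s}.

Definition base (X : Type) (V : superstructure X) : V := setof (range atom).

Section Coding.
Context (X : Type) (V : superstructure X).

Definition opair (a b : V) : V :=
  setof [set setof [set a]; setof [set a; b]].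

(* The value at a of a function f coded by its graph; junk outside the domain. *)
Definition app (f a : V) : V :=
  if pselect (exists b, elem (opair a b) f) is left h then sval (cid h) else a.

End Coding.

(* Formulas of the language {=, in} with bounded quantifiers, in de Bruijn
   style: [FAll i phi] is "for all x in v_i, phi", where phi sees x as v_0. *)
Inductive bformula : Type :=
  | FEq of nat & nat
  | FMem of nat & nat
  | FNot of bformula
  | FAnd of bformula & bformula
  | FAll of nat & bformula.

Fixpoint sat (X : Type) (V : superstructure X) (e : nat -> V) (phi : bformula)
    : Prop :=
  match phi with
  | FEq i j => e i = e j
  | FMem i j => elem (e i) (e j)
  | FNot p => ~ sat e p
  | FAnd p q => sat e p /\ sat e q
  | FAll i p => forall x : V, elem x (e i) ->
      sat (fun j => if j is j'.+1 then e j' else x) p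
  end.

Record nonstandard_extension (X Y : Type) (V : superstructure X)
    (W : superstructure Y) := NonstandardExtension {
  star :> V -> W;
  star_base : star (base V) = base W;
  transfer : forall (phi : bformula) (e : nat -> V),
    sat e phi <-> sat (fun i => star (e i)) phi }.

Definition internal (X Y : Type) (V : superstructure X) (W : superstructure Y)
    (ns : nonstandard_extension V W) (w : W) : Prop :=
  exists a : V, elem w (ns a).

(* Every I-indexed family of internal sets with the finite intersection property
   has nonempty intersection; I = nat is aleph_1-saturation. *)
Definition saturated (X Y : Type) (V : superstructure X) (W : superstructure Y)
    (ns : nonstandard_extension V W) (I : Type) : Prop :=
  forall A : I -> W, (forall i, internal ns (A i)) ->
    (forall D : set I, finite_set D -> exists w, forall i, D i -> elem w (A i)) ->
    exists w, forall i, elem w (A i).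

(* Elements of N `|` {oo}: [None] is oo. *)
Definition le_order (j : nat) (k : option nat) : bool :=
  if k is Some k' then (j <= k')%N else true.

Section Smooth.
Context (R : realType) (m n : nat).
Implicit Types (U : set 'rV[R]_m) (f : 'rV[R]_m -> 'rV[R]_n).

Definition partial (i : 'I_m) f : 'rV[R]_m -> 'rV[R]_n :=
  fun x => 'D_(delta_mx 0 i) f x.

(* Only meant for U open: the derivatives at the points of U then depend only on
   the restriction of f to U, although f is a total function. *)
Fixpoint Cn_on U (k : nat) f : Prop :=
  {within U, continuous f} /\
  if k is k'.+1 then
    forall i : 'I_m, (forall x, U x -> derivable f x (delta_mx 0 i)) /\
                     Cn_on U k' (partial i f)
  else True.

Definition Ck_on U (k : option nat) f : Prop :=
  forall j : nat, le_order j k -> Cn_on U j f.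

Definition mindex := {ffun 'I_m -> nat}.

Definition mlength (a : mindex) : nat := (\sum_(i < m) a i)%N.

(* partial_0^(a 0) (partial_1^(a 1) ( ... f)) *)
Definition mpartial (a : mindex) f : 'rV[R]_m -> 'rV[R]_n :=
  foldr (fun i g => iter (a i) (partial i) g) f (enum 'I_m).

End Smooth.

Arguments mindex : clear implicits.

Section StandardObjects.
Context (R : realType) (V : superstructure R).

(* A point of R^n is the function {0, ..., n-1} -> R of its coordinates. *)
Definition vec n (x : 'rV[R]_n) : V :=
  setof [set opair (atom i%:R) (atom (x 0 i)) | i in [set: 'I_n]].

Definition ltR : V :=
  setof [set p | exists x y : R, x < y /\ p = opair (atom x) (atom y)].

Definition dist n : V :=
  setof [set p | exists x y : 'rV[R]_n,
    p = opair (opair (vec x) (vec y)) (atom `|x - y|)].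

Definition Rn n : V := setof (range (@vec n)).

Definition subset_code m (U : set 'rV[R]_m) : V := setof (@vec m @` U).

(* The map f : U -> R^n, i.e. the restriction to U of a total function. *)
Definition graph m n (U : set 'rV[R]_m) (f : 'rV[R]_m -> 'rV[R]_n) : V :=
  setof [set opair (vec x) (vec (f x)) | x in U].

Definition Ck_code m n (U : set 'rV[R]_m) (k : option nat) : V :=
  setof [set graph U f | f in (Ck_on U k : set ('rV[R]_m -> 'rV[R]_n))].

(* The operator f |-> partial^a f, with domain C^|a|(U, R^n). *)
Definition mpartial_code m n (U : set 'rV[R]_m) (a : mindex m) : V :=
  setof [set opair (graph U f) (graph U (mpartial a f))
        | f in (Ck_on U (Some (mlength a)) : set ('rV[R]_m -> 'rV[R]_n))].

End StandardObjects.

Arguments graph {R} V {m n} U f.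

Section Nonstandard.
Context (R : realType) (Y : Type) (V : superstructure R) (W : superstructure Y).
Variable ns : nonstandard_extension V W.

Definition infinitesimal (t : W) : Prop :=
  forall e : R, 0 < e ->
    elem (opair (ns (atom (- e))) t) (ns (ltR V)) /\
    elem (opair t (ns (atom e))) (ns (ltR V)).

(* a ~ b for a, b in *R^n; [dist] uses the max norm of the library, which gives
   the same relation as the Euclidean norm since n is standard. *)
Definition infclose n (a b : W) : Prop :=
  infinitesimal (app (ns (dist V n)) (opair a b)).

Definition nearstandard n (a : W) : Prop :=
  elem a (ns (Rn V n)) /\ exists y : 'rV[R]_n, infclose n a (ns (vec V y)).

Definition st n (a : W) : 'rV[R]_n :=
  xget 0 [set y : 'rV[R]_n | infclose n a (ns (vec V y))].

Definition nes m (U : set 'rV[R]_m) (xi : W) : Prop :=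
  elem xi (ns (subset_code V U)) /\
  exists2 x : 'rV[R]_m, U x & infclose m xi (ns (vec V x)).

Section Maps.
Context (m n : nat) (U : set 'rV[R]_m).

Definition ipartial (a : mindex m) (f : W) : W :=
  app (ns (mpartial_code V n U a)) f.

Definition SC0 (f : W) : Prop :=
  (forall xi, nes U xi -> nearstandard n (app f xi)) /\
  (forall xi zeta, nes U xi -> nes U zeta -> infclose m xi zeta ->
     infclose n (app f xi) (app f zeta)).

Definition SC (k : option nat) (f : W) : Prop :=
  elem f (ns (Ck_code V n U k)) /\
  forall a : mindex m, le_order (mlength a) k -> SC0 (ipartial a f).

(* The standard part of an internal map; it exists when f takes nearstandard
   values at the points *x, x in U. *)
Definition st_map (f : W) : 'rV[R]_m -> 'rV[R]_n :=
  fun x => st n (app f (ns (vec V x))).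

Definition st_map_exists (f : W) : Prop :=
  forall x, U x -> nearstandard n (app f (ns (vec V x))).

End Maps.
End Nonstandard.

Arguments infclose {R Y V W} ns n a b.
Arguments nearstandard {R Y V W} ns n a.
Arguments st {R Y V W} ns n a.
Arguments nes {R Y V W} ns {m} U xi.
Arguments ipartial {R Y V W} ns {m} n U a f.
Arguments SC0 {R Y V W} ns {m} n U f.
Arguments SC {R Y V W} ns {m} n U k f.
Arguments st_map {R Y V W} ns m n f.
Arguments st_map_exists {R Y V W} ns {m} n U f.

(* Main.v *)
Require Import Defs.
From mathcomp Require Import all_boot all_order all_algebra.
From mathcomp Require Import all_classical all_reals all_analysis.
From mathcomp Require Import ring lra.
Import numFieldNormedType.Exports.

Set Implicit Arguments.
Unset Strict Implicit.
Unset Printing Implicit Defensive.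

Import Order.TTheory GRing.Theory Num.Theory.

Local Open Scope classical_set_scope.
Local Open Scope ring_scope.

(* A standard set A of C^k maps is declared large when the internal map f lies
   in *A. The large sets form a proper filter, along which the derivatives of
   standard C^k maps h at a standard point x converge to the standard parts of
   the derivatives of f at *x. S-continuity and saturation make the derivatives
   equicontinuous along the filter, so by the mean value theorem the limits of
   the derivatives are the derivatives of the limit; this is (1). Since only the
   ordered derivatives d^a are controlled, Schwarz's theorem is needed to reach
   every iterated derivative. (2) and (3) follow by comparing the values at a
   nearstandard xi ~ *x with those at *x. *)

(** Calculus is never carried out in the nonstandard universe. Transferring the mean value theorem
    to an internal map would require coding one-variable calculus as bounded formulas; the filter
    lets all analysis be done on standard maps h, and transfer only shows that f lies in the star of
    a set such as the h with |d^a h(x) - y| < e. Convergence along the filter is merely pointwise: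
    the large set depends on x and e. What makes limit and derivative interchange is that the
    equicontinuity radius is a standard number fixed before h. It is obtained by contradiction from
    the countably many radii 1/(j+1), which is why saturation over [nat] suffices. *)

(** * Pairs and functions in a superstructure *)

Section SuperstructureTheory.
Context (X : Type) (V : superstructure X).
Implicit Types (a b c d : V) (P : set V).

Notation level := (level (@atom X V) (@elem X V)).

Lemma level_le i j : (i <= j)%N -> level i `<=` level j.
Proof.
elim: j => [|j IH]; first by rewrite leqn0 => /eqP ->.
by rewrite leq_eqVlt => /orP[/eqP -> //|ij] x /(IH ij) xj; left.
Qed.

Lemma level_setof j P : P `<=` level j -> level j.+1 (setof P).
Proof.
move=> Pj; right; split; first exact: setof_not_atom Pj.
by move=> c /= /(elem_setof Pj) /Pj.
Qed.

Definition bounded P := exists j, P `<=` level j.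

Lemma elem_setofE P c : bounded P -> elem c (setof P) <-> P c.
Proof. by move=> [j Pj]; exact: elem_setof Pj c. Qed.

Lemma bounded2 a b : bounded [set a; b].
Proof.
have [i ai] := finite_rank a; have [j bj] := finite_rank b.
exists (maxn i j) => c /= [->|->]; first exact: level_le (leq_maxl i j) _ ai.
exact: level_le (leq_maxr i j) _ bj.
Qed.

Lemma bounded1 a : bounded [set a].
Proof. by have [j aj] := finite_rank a; exists j => c ->. Qed.

Lemma elem_set1 a c : elem c (setof [set a]) <-> c = a.
Proof. exact/elem_setofE/bounded1. Qed.

Lemma elem_set2 a b c : elem c (setof [set a; b]) <-> c = a \/ c = b.
Proof. exact/elem_setofE/bounded2. Qed.

Lemma not_atom1 a : ~ range atom (setof [set a]).
Proof. by have [j aj] := bounded1 a; exact: setof_not_atom aj. Qed.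

Lemma not_atom2 a b : ~ range atom (setof [set a; b]).
Proof. by have [j aj] := bounded2 a b; exact: setof_not_atom aj. Qed.

Lemma elem_not_atom a c : elem c a -> ~ range atom a.
Proof. by move=> ca [x _ ax]; move: ca; rewrite -ax; exact: elem_atom. Qed.

(** On the right the quantifier runs over members of c only, the one form of quantification that a
    bounded formula has. *)
Lemma eq_set1P a c :
  c = setof [set a] <-> elem a c /\ (forall d, elem d c -> d = a).
Proof.
split=> [->|[ac ca]]; first by split=> [|d]; rewrite elem_set1.
apply: set_ext => [||d]; [exact: elem_not_atom ac|exact: not_atom1|].
by rewrite elem_set1; split=> [/ca|->].
Qed.

Lemma eq_set2P a b c : c = setof [set a; b] <->
  [/\ elem a c, elem b c & forall d, elem d c -> d = a \/ d = b].
Proof.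
split=> [->|[ac bc cab]].
  by split=> [||d]; rewrite elem_set2; [left|right|].
apply: set_ext => [||d]; [exact: elem_not_atom ac|exact: not_atom2|].
by rewrite elem_set2; split=> [/cab|[->|->]].
Qed.

Lemma setof1_inj a b : setof [set a] = setof [set b] -> a = b.
Proof. by move=> /eq_set1P[/elem_set1]. Qed.

Lemma opair_inj a b c d : opair a b = opair c d -> a = c /\ b = d.
Proof.
have elp a' b' e : elem e (opair a' b') <-> e = setof [set a'] \/ e = setof [set a'; b'].
  exact: elem_set2.
move=> E.
have ac : a = c.
  have : elem (setof [set a]) (opair c d) by rewrite -E elp; left.
  move=> /elp[/setof1_inj//|/esym /eq_set1P E1].
  have [_ /(_ c)] := E1; rewrite elem_set2 => h.
  by have /esym := h (or_introl erefl).
rewrite -{}ac in E *; split=> //.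
(* The degenerate pair with b' = a is the obstacle. Using the claim in both directions leaves either
   b = d or b = a = d. *)
have h b' d' : opair a b' = opair a d' -> b' = d' \/ b' = a.
  move=> E'; have : elem (setof [set a; b']) (opair a d') by rewrite -E' elp; right.
  move=> /elp[/eq_set1P[_ /(_ b')]|/eq_set2P[_ _ /(_ b')]]; rewrite elem_set2.
    by move=> /(_ (or_intror erefl)); right.
  by move=> /(_ (or_intror erefl))[]; [right|left].
have [//|ba] := h _ _ E; have [//|da] := h _ _ (esym E).
by rewrite ba da.
Qed.

Lemma level_opair j a b : level j a -> level j b -> level j.+2 (opair a b).
Proof.
move=> aj bj; apply: level_setof => c /= [->|->]; apply: level_setof => d /=.
  by move->.
by case=> ->.
Qed.

(* Only quantifiers bounded by [c] and its members occur on the right. *)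
Lemma opairP a b c : c = opair a b <->
  exists2 z1, elem z1 c & exists2 z2, elem z2 c &
   [/\ elem a z1 /\ (forall d, elem d z1 -> d = a),
   [/\ elem a z2, elem b z2 & forall d, elem d z2 -> d = a \/ d = b]
  & forall z, elem z c -> z = z1 \/ z = z2].
Proof.
split=> [->|[z1 z1c [z2 z2c [/eq_set1P z1a /eq_set2P z2a cz]]]]; last first.
  by apply/eq_set2P; rewrite -z1a -z2a; split.
exists (setof [set a]); first by rewrite elem_set2; left.
exists (setof [set a; b]); first by rewrite elem_set2; right.
by split; [exact/eq_set1P|exact/eq_set2P|move=> z /elem_set2].
Qed.

(** [app] is junk where no value exists, so totality on D and uniqueness are stated together; this
    predicate is then transferred as a whole. *)
Definition isfun (F D C : V) :=
  [/\ forall p, elem p F -> exists x, elem x D /\ exists y, elem y C /\ p = opair x y,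
      forall x, elem x D -> exists y, elem y C /\ elem (opair x y) F
    & forall x y y', elem (opair x y) F -> elem (opair x y') F -> y = y'].

Lemma isfun_app F D C a b : isfun F D C -> elem a D ->
  elem (opair a b) F <-> b = app F a.
Proof.
move=> [_ h hu] /h[y [_ ay]]; rewrite /app; case: pselect => [e|]; last by case; exists y.
by case: cid => z /= az; split=> [/hu/(_ az)|->].
Qed.

Lemma isfun_dom F D C a b : isfun F D C -> elem (opair a b) F -> elem a D /\ elem b C.
Proof. by move=> [h _ _] /h[x [xD [y [yC /opair_inj[-> ->]]]]]. Qed.

Lemma isfun_appP F D C a : isfun F D C -> elem a D ->
  elem (opair a (app F a)) F /\ elem (app F a) C.
Proof.
move=> FDC aD; have aF : elem (opair a (app F a)) F by apply/(isfun_app _ FDC aD).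
by split=> //; have [] := isfun_dom FDC aF.
Qed.

End SuperstructureTheory.

(** * Transfer for formulas with named variables *)

(** On numerals [eqn] computes, so that an [xsat] of a concrete formula is convertible to the
    statement it encodes. *)
Definition upd (T : Type) (e : nat -> T) (i : nat) (x : T) : nat -> T :=
  fun j => if eqn j i then x else e j.

(* Formulas with named variables, ordered pairs and function symbols as
   primitive notions; [compile] eliminates them in favour of [bformula]. *)
Inductive xformula : Type :=
  | XEq of nat & nat
  | XMem of nat & nat
  | XPMem of nat & nat & nat
  | XPair of nat & nat & nat
  | XFun of nat & nat & nat
  | XNot of xformula
  | XAnd of xformula & xformula
  | XImp of xformula & xformula
  | XIff of xformula & xformula
  | XAll of nat & nat & xformula
  | XEx of nat & nat & xformula.

Fixpoint xsat (X : Type) (V : superstructure X) (e : nat -> V) (phi : xformula)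
    : Prop :=
  match phi with
  | XEq i j => e i = e j
  | XMem i j => elem (e i) (e j)
  | XPMem i j l => elem (opair (e i) (e j)) (e l)
  | XPair p i j => e p = opair (e i) (e j)
  | XFun f a b => isfun (e f) (e a) (e b)
  | XNot p => ~ xsat e p
  | XAnd p q => xsat e p /\ xsat e q
  | XImp p q => xsat e p -> xsat e q
  | XIff p q => xsat e p <-> xsat e q
  | XAll x i p => forall v : V, elem v (e i) -> xsat (upd e x v) p
  | XEx x i p => exists v : V, elem v (e i) /\ xsat (upd e x v) p
  end.

Definition FImp p q := FNot (FAnd p (FNot q)).
Definition FOr p q := FNot (FAnd (FNot p) (FNot q)).
Definition FEx i p := FNot (FAll i (FNot p)).

(** This is [opairP] in de Bruijn form: under the two existentials z1 is index 1 and z2 is index 0,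
    and the outer variables are shifted by two. *)
Definition FPair p i j :=
  FEx p (FEx p.+1
    (FAnd (FAnd (FMem i.+2 1) (FAll 1 (FEq 0 i.+3)))
    (FAnd (FAnd (FMem i.+2 0) (FAnd (FMem j.+2 0)
            (FAll 0 (FOr (FEq 0 i.+3) (FEq 0 j.+3)))))
     (FAll p.+2 (FOr (FEq 0 2) (FEq 0 1)))))).

Definition FPMem i j l := FEx l (FPair 0 i.+1 j.+1).

(** The uniqueness clause of [isfun] has unbounded quantifiers. Here they are bounded by a and b,
    which is equivalent because the first clause puts both components of every pair of f there. *)
Definition FFun f a b :=
  FAnd (FAll f (FEx a.+1 (FEx b.+2 (FPair 2 1 0))))
  (FAnd (FAll a (FEx b.+1 (FPMem 1 0 f.+2)))
        (FAll a (FAll b.+1 (FAll b.+2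
           (FImp (FPMem 2 1 f.+3) (FImp (FPMem 2 0 f.+3) (FEq 1 0))))))).

Definition shift_names (r : nat -> nat) (x : nat) : nat -> nat :=
  fun j => if eqn j x then 0%N else (r j).+1.

Fixpoint compile (r : nat -> nat) (phi : xformula) : bformula :=
  match phi with
  | XEq i j => FEq (r i) (r j)
  | XMem i j => FMem (r i) (r j)
  | XPMem i j l => FPMem (r i) (r j) (r l)
  | XPair p i j => FPair (r p) (r i) (r j)
  | XFun f a b => FFun (r f) (r a) (r b)
  | XNot p => FNot (compile r p)
  | XAnd p q => FAnd (compile r p) (compile r q)
  | XImp p q => FImp (compile r p) (compile r q)
  | XIff p q => FAnd (FImp (compile r p) (compile r q))
                     (FImp (compile r q) (compile r p))
  | XAll x i p => FAll (r i) (compile (shift_names r x) p)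
  | XEx x i p => FEx (r i) (compile (shift_names r x) p)
  end.

Section Compile.
Context (X : Type) (V : superstructure X).
Implicit Types e : nat -> V.

Lemma sat_imp e p q : sat e (FImp p q) <-> (sat e p -> sat e q).
Proof. by rewrite /= not_andP notK implyE. Qed.

Lemma sat_or e p q : sat e (FOr p q) <-> sat e p \/ sat e q.
Proof. by rewrite /= not_andP !notK. Qed.

Lemma sat_and e p q : sat e (FAnd p q) <-> sat e p /\ sat e q.
Proof. by []. Qed.

Lemma sat_all e i p : sat e (FAll i p) <->
  forall v, elem v (e i) -> sat (fun j => if j is j'.+1 then e j' else v) p.
Proof. by []. Qed.

Lemma sat_ex e i p : sat e (FEx i p) <->
  exists v, elem v (e i) /\ sat (fun j => if j is j'.+1 then e j' else v) p.
Proof.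
rewrite /=; split=> [/existsNP[v /not_implyP[vi /contrapT pv]]|]; first by exists v.
by move=> [v [vi pv]] /(_ v vi).
Qed.

Lemma sat_pair e p i j : sat e (FPair p i j) <-> e p = opair (e i) (e j).
Proof.
rewrite opairP sat_ex; split.
  move=> [z1 [z1p /sat_ex[z2 [z2p [h1 [[h2 [h3 h4]] h5]]]]]].
  exists z1 => //; exists z2 => //; split=> //.
    by split=> // d dz; exact: (sat_or _ (FEq 0 i.+3) (FEq 0 j.+3)).1 (h4 d dz).
  by move=> z zp; exact: (sat_or _ (FEq 0 2) (FEq 0 1)).1 (h5 z zp).
move=> [z1 z1p [z2 z2p [h1 [h2 h3 h4] h5]]].
exists z1; split=> //; apply/sat_ex; exists z2; split=> //; split=> //.
split; last by move=> z zp; apply: (sat_or _ (FEq 0 2) (FEq 0 1)).2; exact: h5.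
by do 2![split=> //] => d dz; apply: (sat_or _ (FEq 0 i.+3) (FEq 0 j.+3)).2; exact: h4.
Qed.

Lemma sat_pmem e i j l : sat e (FPMem i j l) <-> elem (opair (e i) (e j)) (e l).
Proof.
rewrite sat_ex; split; first by move=> [v [vl /sat_pair /= <-]].
by move=> h; eexists; split; [exact: h|exact/sat_pair].
Qed.

Lemma sat_fun e f a b : sat e (FFun f a b) <-> isfun (e f) (e a) (e b).
Proof.
rewrite /FFun !sat_and !sat_all; split.
  move=> [h1 [h2 h3]]; split.
  - move=> p /h1 /sat_ex[x [xa /sat_ex[y [yb /sat_pair /= ->]]]].
    by exists x; split=> //; exists y.
  - by move=> x /h2 /sat_ex[y [yb /sat_pmem xy]]; exists y.
  - have hd x y : elem (opair x y) (e f) -> elem x (e a) /\ elem y (e b).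
      by move=> /h1 /sat_ex[x' [xa /sat_ex[y' [yb /sat_pair /= /opair_inj[-> ->]]]]].
    move=> x y y' xy xy'; have [xa yb] := hd _ _ xy; have [_ yb'] := hd _ _ xy'.
    have /sat_all/(_ y yb)/sat_all/(_ y' yb')/sat_imp := h3 x xa.
    by rewrite sat_pmem => /(_ xy) /sat_imp; rewrite sat_pmem => /(_ xy').
move=> [h1 h2 h3]; split; [|split].
- move=> p /h1[x [xa [y [yb pE]]]]; apply/sat_ex; exists x; split=> //.
  by apply/sat_ex; exists y; split=> //; exact/sat_pair.
- by move=> x /h2[y [yb xy]]; apply/sat_ex; exists y; split=> //; exact/sat_pmem.
- move=> x xa; apply/sat_all => y yb; apply/sat_all => y' yb'; apply/sat_imp => /sat_pmem xy.
  by apply/sat_imp => /sat_pmem xy'; exact: h3 xy xy'.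
Qed.

Lemma sat_compile phi r e : sat e (compile r phi) <-> xsat (e \o r) phi.
Proof.
(* The two conventions for variables meet here: pushing v in front of the environment is the same as
   rebinding the name x, once the other names are shifted. *)
have upE (e' : nat -> V) (r' : nat -> nat) x v :
    (fun j => if j is j'.+1 then e' j' else v) \o shift_names r' x =
    upd (e' \o r') x v.
  by apply/funext => j; rewrite /upd /shift_names /=; case: eqn.
elim: phi r e => /= [||i j l|i j l|i j l|p IH|p IHp q IHq|p IHp q IHq|p IHp q IHq
    |x i p IH|x i p IH] r e //.
- exact: sat_pmem.
- exact: sat_pair.
- exact: sat_fun.
- by rewrite IH.
- by rewrite IHp IHq.
- by rewrite -IHp -IHq; exact: sat_imp.
- have := sat_imp e (compile r p) (compile r q).
  have := sat_imp e (compile r q) (compile r p).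
  rewrite /= => -> ->; rewrite -IHp -IHq.
  by split=> [[]|[]].
- by split=> h v /h; rewrite IH upE.
- have := sat_ex e (r i) (compile (shift_names r x) p); rewrite /= => ->.
  by split=> -[v [vi h]]; exists v; split=> //; move: h; rewrite IH upE.
Qed.

End Compile.

Lemma xtransfer (X Y : Type) (V : superstructure X) (W : superstructure Y)
    (ns : nonstandard_extension V W) (phi : xformula) (e : nat -> V) :
  xsat e phi <-> xsat (fun i => ns (e i)) phi.
Proof.
have := transfer ns (compile id phi) e.
by rewrite !sat_compile.
Qed.

(** In every transferred formula the parameters are listed in [s], and bound variables are named
    from the length of [s] upward, so that [upd] overwrites no parameter. *)
Definition env (T : Type) (x0 : T) (s : seq T) : nat -> T := nth x0 s.

(** * Mean value inequality and symmetry of mixed derivatives *)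

(** Directional derivatives depend only on the increment as a function of h. This carries them over
    to translates and to restrictions to a line. *)
Lemma eq_growth_rate (R : numFieldType) (E E' W : normedModType R)
    (f : E -> W) (f' : E' -> W) x v x' v' :
  (forall h : R, f (h *: v + x) - f x = f' (h *: v' + x') - f' x') ->
  derivable f x v = derivable f' x' v' /\ 'D_v f x = 'D_v' f' x'.
Proof.
move=> ff'; rewrite /derivable /derive.
set g := fun h => h^-1 *: _; set g' := fun h => h^-1 *: _.
suff -> : g = g' by [].
by apply/funext => h; rewrite /g /g' /= ff'.
Qed.

Section LineRestriction.
Context (R : realType) (E : normedModType R).
Implicit Types (x u v : E) (s t : R).

Lemma is_derive_line (W : normedModType R) (f : E -> W) x u s :
  derivable f (x + s *: u) u ->
  is_derive s 1 (fun s => f (x + s *: u)) ('D_u f (x + s *: u)).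
Proof.
have [|-> ->] := @eq_growth_rate _ _ R^o _ f (fun s => f (x + s *: u)) (x + s *: u) u s 1.
  by move=> h; rewrite [h%:A]mulr1 scalerDl addrCA.
by move=> fs; apply: DeriveDef.
Qed.

Lemma MVT_line (g : E -> R) x u t :
  (forall s, `|s| <= `|t| -> derivable g (x + s *: u) u) ->
  exists2 c, `|c| <= `|t| & g (x + t *: u) - g x = 'D_u g (x + c *: u) * t.
Proof.
move=> gu.
(* The mean value theorem wants an ordered interval, while t may have either sign: [main] is applied
   to [0, t] or to [t, 0]. *)
have main a b : a <= b -> (forall s, a <= s <= b -> `|s| <= `|t|) ->
    exists2 c, `|c| <= `|t| &
      g (x + b *: u) - g (x + a *: u) = 'D_u g (x + c *: u) * (b - a).
  move=> ab abt.
  have dg s : s \in `[a, b] -> is_derive s 1 (fun s => g (x + s *: u)) ('D_u g (x + s *: u)).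
    by rewrite in_itv /= => sab; apply/is_derive_line/gu/abt.
  have dgo s : s \in `]a, b[ -> is_derive s 1 (fun s => g (x + s *: u)) ('D_u g (x + s *: u)).
    by rewrite in_itv /= => /andP[as_ sb]; apply: dg; rewrite in_itv /= !ltW.
  have cg : {within `[a, b], continuous (fun s => g (x + s *: u))}.
    by apply: derivable_within_continuous => s /dg [].
  have [c] := MVT_segment ab dgo cg.
  by rewrite in_itv /= => cab ->; exists c => //; exact: abt.
have x0 : x + 0 *: u = x by rewrite scale0r addr0.
have [t0|t0] := leP 0 t.
  have [|c ct] := main 0 t t0.
    by move=> s /andP[s0 st]; rewrite !ger0_norm.
  by rewrite x0 subr0 => ->; exists c.
have [|c ct] := main t 0 (ltW t0).
  by move=> s /andP[ts s0]; rewrite ler0_norm// ltr0_norm// lerN2.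
rewrite x0 sub0r mulrN => h; exists c => //.
by rewrite -[LHS]opprB h opprK.
Qed.

(** Two mean value steps: one along u for k(y) = g(y + tv) - g(y), then one along v for the
    derivative of g along u. *)
Lemma second_difference (g : E -> R) x u v t :
  (forall s r, `|s| <= `|t| -> `|r| <= `|t| ->
     derivable g (x + s *: u + r *: v) u /\
     derivable ('D_u g) (x + s *: u + r *: v) v) ->
  exists s r, [/\ `|s| <= `|t|, `|r| <= `|t| &
    g (x + t *: u + t *: v) - g (x + t *: u) - (g (x + t *: v) - g x) =
    'D_v ('D_u g) (x + s *: u + r *: v) * t * t].
Proof.
move=> h; pose k y := g (y + t *: v) - g y.
have sE y := eq_growth_rate (f := fun y => g (y + t *: v)) (x := y)
  (f' := g) (v := u) (v' := u) (x' := y + t *: v) (fun h => congr1 (fun z => g z - _) (esym (addrA _ _ _))).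
have sv y : derivable g (y + t *: v) u -> derivable (fun y => g (y + t *: v)) y u.
  by rewrite (sE y).1.
have svE y : 'D_u (fun y => g (y + t *: v)) y = 'D_u g (y + t *: v) := (sE y).2.
have g0 s : `|s| <= `|t| -> derivable g (x + s *: u) u.
  move=> st; have [|] := h s 0 st; first by rewrite normr0.
  by rewrite scale0r addr0.
have gt s : `|s| <= `|t| -> derivable g (x + s *: u + t *: v) u.
  by move=> st; exact: (h s t st (lexx _)).1.
have [s st|c ct kE] := @MVT_line k x u t.
  by apply: derivableB; [apply/sv/gt|exact: g0].
have [r rt|r rt rE] := @MVT_line ('D_u g) (x + c *: u) v t.
  by have [] := h c r ct rt.
exists c, r; split=> //.
rewrite -rE; move: kE; rewrite /k => ->; congr (_ * _).
rewrite deriveB; [by rewrite svE|by apply/sv/gt|exact: g0].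
Qed.

(** The second difference is symmetric in u and v, so cancelling t * t equates the two mixed
    derivatives, each at its own intermediate point. *)
Lemma second_difference_eq (F G g : E -> R) x u v t s r s' r' : 0 < t ->
  g (x + t *: u + t *: v) - g (x + t *: u) - (g (x + t *: v) - g x) =
    F (x + s *: u + r *: v) * t * t ->
  g (x + t *: v + t *: u) - g (x + t *: v) - (g (x + t *: u) - g x) =
    G (x + s' *: v + r' *: u) * t * t ->
  F (x + s *: u + r *: v) = G (x + r' *: u + s' *: v).
Proof.
move=> t0 sE sE'; apply: (mulIf (lt0r_neq0 t0)); apply: (mulIf (lt0r_neq0 t0)).
have sw (a b c d : R) : a - b - (c - d) = a - c - (b - d) by ring.
by rewrite -sE (addrAC x (r' *: u)) -sE' (addrAC x (t *: v)); exact: sw.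
Qed.

Lemma dist_le_half (a b c e : R) :
  `|a - b| < e / 2 -> `|c - b| < e / 2 -> `|a - c| <= e.
Proof.
move=> ab cb; rewrite (splitr e) (le_trans (ler_distD b _ _))// lerD ?ltW//.
by rewrite distrC.
Qed.

Lemma schwarz (g : E -> R) x u v :
  (\forall y \near x, [/\ derivable g y u, derivable g y v,
     derivable ('D_u g) y v & derivable ('D_v g) y u]) ->
  {for x, continuous ('D_v ('D_u g))} -> {for x, continuous ('D_u ('D_v g))} ->
  'D_v ('D_u g) x = 'D_u ('D_v g) x.
Proof.
move=> gx cuv cvu; apply/eqP; rewrite -subr_eq0 -normr_le0.
apply/ler_addgt0Pl => e e0; rewrite addr0.
have e2 : 0 < e / 2 by rewrite divr_gt0.
have /cvgrPdist_lt/(_ _ e2) cu := cuv.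
have /cvgrPdist_lt/(_ _ e2) cv := cvu.
have : \forall t \near (0 : R), forall s r, `|s| <= `|t| -> `|r| <= `|t| ->
   let y := x + s *: u + r *: v in
  [/\ derivable g y u, derivable g y v,
     derivable ('D_u g) y v & derivable ('D_v g) y u] /\
  (`|'D_v ('D_u g) x - 'D_v ('D_u g) y| < e / 2 /\
   `|'D_u ('D_v g) x - 'D_u ('D_v g) y| < e / 2).
  have [d /= d0 dB] := (nbhs_ballP x _).1 (filterI gx (filterI cu cv)).
  (* The offset s u + r v has norm at most |t| (|u| + |v|); the extra 1 keeps the denominator
     positive when u = v = 0. *)
  have D0 : 0 < 1 + `|u| + `|v| by rewrite -addrA ltr_pwDl// addr_ge0.
  exists (d / (1 + `|u| + `|v|)) => /=; first by rewrite divr_gt0.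
  move=> t; rewrite /ball_ /= sub0r normrN => td s r st rt.
  apply: dB; rewrite -ball_normE /ball_ /= -addrA opprD addrA subrr sub0r normrN.
  rewrite (le_lt_trans (ler_normD _ _))// !normrZ.
  apply: (@le_lt_trans _ _ (`|t| * (1 + `|u| + `|v|))).
    rewrite !mulrDr -addrA ler_wpDl ?mulr1 //.
    by rewrite lerD // ler_wpM2r.
  by rewrite -ltr_pdivlMr.
move=> /(nbhs_ballP (0 : R) _).1 [d /= d0 dB].
pose t := d / 2; have t0 : 0 < t by rewrite divr_gt0.
have bt : ball (0 : R) d t.
  by rewrite /ball /= sub0r normrN gtr0_norm// /t ltr_pdivrMr// ltr_pMr// ltr1n.
have {bt}dB := dB t bt.
have [s r st rt|s [r [st rt sE]]] := @second_difference g x u v t.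
  by have [[]] := dB s r st rt.
have [s' r' st' rt'|s' [r' [st' rt' sE']]] := @second_difference g x v u t.
  have H y : y = x + r' *: u + s' *: v -> derivable g y v /\ derivable ('D_v g) y u.
    by move=> ->; have [[_ h1 _ h2] _] := dB r' s' rt' st'; exact: (conj h1 h2).
  exact/H/addrAC.
have [_ [h _]] := dB s r st rt.
have [_ [_ h']] := dB r' s' rt' st'.
(* Both mixed derivatives at x are now within e / 2 of one common number. *)
have E1 := second_difference_eq (F := 'D_v ('D_u g)) (G := 'D_u ('D_v g)) (g := g) t0 sE sE'.
by rewrite -E1 in h'; exact: dist_le_half h h'.
Qed.

Lemma mx_norm_le p q (A : 'M[R]_(p, q)) (e : R) :
  0 <= e -> (forall i j, `|A i j| <= e) -> `|A| <= e.
Proof.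
move=> e0 h; rewrite /Num.Def.normr /= mx_normrE.
by apply: bigmax_le => // i _; exact: h.
Qed.

Lemma le_mx_norm p q (A : 'M[R]_(p, q)) i j : `|A i j| <= `|A|.
Proof.
rewrite [leRHS]/Num.Def.normr /= mx_normrE.
exact: (le_bigmax _ (fun ij : 'I_p * 'I_q => `|A ij.1 ij.2|) (i, j)).
Qed.

(** A vector-valued map has no single intermediate point. Each entry gets its own, and the bound
    against a fixed L holds at all of them, hence in the max norm. *)
Lemma MVT_line_mx p q (f : E -> 'M[R]_(p, q)) x u t L (e : R) :
  (forall s, `|s| <= `|t| -> derivable f (x + s *: u) u) ->
  (forall s, `|s| <= `|t| -> `|'D_u f (x + s *: u) - L| <= e) ->
  `|f (x + t *: u) - f x - t *: L| <= e * `|t|.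
Proof.
move=> df de; have e0 : 0 <= e.
  by apply: le_trans (de 0 _); rewrite ?normr0.
apply: mx_norm_le => [|i j]; first by rewrite mulr_ge0.
have [s st|c ct cE] := @MVT_line (fun y => f y i j) x u t.
  exact: (derivable_mxP _ _ _).1 (df s st) i j.
rewrite !mxE cE mulrC -mulrBr normrM mulrC ler_wpM2r //.
apply: le_trans (de c ct); rewrite derive_mx; last exact: df.
by apply: le_trans (le_mx_norm _ i j); rewrite !mxE.
Qed.

End LineRestriction.

(** * Iterated partial derivatives on an open set *)

Section OpenSmooth.
Context (R : realType) (m n : nat) (U : set 'rV[R]_m) (hU : open U).
Local Notation map := ('rV[R]_m -> 'rV[R]_n).
Local Notation unitv i := (delta_mx 0 i : 'rV[R]_m).
Implicit Types (f g h : map) (w : seq 'I_m) (x y : 'rV[R]_m).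

(** A code [graph V U f] remembers f on U only, so the notions of smoothness have to be invariant
    under this relation. *)
Definition eq_on f g := forall x, U x -> f x = g x.

Lemma near_open x : U x -> \forall y \near x, U y.
Proof. by move=> Ux; exact: open_nbhs_nbhs. Qed.

Lemma near_eq_on f g x : eq_on f g -> U x -> \forall y \near x, f y = g y.
Proof. by move=> fg /near_open; apply: filterS => y; exact: fg. Qed.

Lemma eq_on_sym f g : eq_on f g -> eq_on g f.
Proof. by move=> fg x /fg. Qed.

Lemma partial_eq_on f g i : eq_on f g -> eq_on (partial i f) (partial i g).
Proof. by move=> fg x Ux; apply: near_eq_derive; exact: near_eq_on. Qed.

Lemma derivable_eq_on f g x v :
  eq_on f g -> U x -> derivable f x v -> derivable g x v.
Proof. by move=> fg Ux; apply: near_eq_derivable; exact: near_eq_on. Qed.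

Lemma continuous_openP f :
  {within U, continuous f} <-> forall x, U x -> {for x, continuous f}.
Proof. by rewrite continuous_open_subspace// in_setP. Qed.

Lemma within_continuous_eq_on f g :
  eq_on f g -> {within U, continuous f} -> {within U, continuous g}.
Proof. by move=> fg; apply: subspace_eq_continuous => x; rewrite inE => /fg. Qed.

Lemma Cn_on_eq_on j f g : eq_on f g -> Cn_on U j f -> Cn_on U j g.
Proof.
elim: j f g => [|j IH] f g fg /= [fc fS]; split=> //.
- exact: within_continuous_eq_on fc.
- exact: within_continuous_eq_on fc.
- move=> i; have [df pf] := fS i; split.
    by move=> x Ux; apply: derivable_eq_on (df x Ux).
  by apply: IH pf; exact: partial_eq_on.
Qed.

Lemma Ck_on_eq_on k f g : eq_on f g -> Ck_on U k f -> Ck_on U k g.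
Proof. by move=> fg fk j /fk; exact: Cn_on_eq_on. Qed.

Definition wpartial w f : map := foldr (@partial R m n) f w.

Lemma wpartial_eq_on w f g : eq_on f g -> eq_on (wpartial w f) (wpartial w g).
Proof. by move=> fg; elim: w => //= i w; exact: partial_eq_on. Qed.

Lemma wpartial_rcons w i f : wpartial (rcons w i) f = wpartial w (partial i f).
Proof. by rewrite /wpartial foldr_rcons. Qed.

Lemma wpartial_cat w w' f : wpartial (w ++ w') f = wpartial w (wpartial w' f).
Proof. by rewrite /wpartial foldr_cat. Qed.

(** [Cn_on] takes the innermost derivative first, which is the last letter of a word; hence the case
    analysis at the end of w. *)
Lemma Cn_onP j f : Cn_on U j f <->
  (forall w, (size w <= j)%N -> {within U, continuous (wpartial w f)}) /\
  (forall w i x, (size w < j)%N -> U x -> derivable (wpartial w f) x (unitv i)).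
Proof.
elim: j f => [|j IH] f; split.
- by move=> [fc _]; split=> [[|i w]|].
- by move=> [fc _]; split=> //; exact: (fc [::]).
- move=> [fc fS]; split=> [w|w i x]; case: (lastP w) => [|{}w l].
  + by [].
  + rewrite size_rcons ltnS wpartial_rcons => wj.
    by have [_ /IH[+ _]] := fS l; exact.
  + by move=> _ Ux; exact: (fS i).1.
  + rewrite size_rcons ltnS wpartial_rcons => wj Ux.
    by have [_ /IH[_ +]] := fS l; exact.
- move=> [fc fd]; split; first exact: (fc [::]).
  move=> i; split; first by move=> x; exact: (fd [::]).
  apply/IH; split=> [w wj|w l x wj Ux]; rewrite -wpartial_rcons.
    by apply: fc; rewrite size_rcons.
  by apply: fd => //; rewrite size_rcons.
Qed.

Lemma Cn_on_le i j f : (i <= j)%N -> Cn_on U j f -> Cn_on U i f.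
Proof.
move=> ij /Cn_onP[fc fd]; apply/Cn_onP; split=> [w wi|w l x wi].
  exact/fc/(leq_trans wi).
exact/fd/(leq_trans wi).
Qed.

Lemma Cn_on_partial j w f : Cn_on U (size w + j) f -> Cn_on U j (wpartial w f).
Proof.
move=> /Cn_onP[fc fd]; apply/Cn_onP; split=> [w' w'j|w' i x w'j Ux].
  by rewrite -wpartial_cat; apply: fc; rewrite size_cat addnC leq_add2l.
by rewrite -wpartial_cat; apply: fd => //; rewrite size_cat addnC ltn_add2l.
Qed.

Lemma partial_coord f i c y : derivable f y (unitv i) ->
  partial i f y 0 c = 'D_(unitv i) (fun y => f y 0 c) y.
Proof. by move=> dfy; rewrite /partial derive_mx// mxE. Qed.

Lemma derivable_coord f y v c :
  derivable f y v -> derivable (fun y => f y 0 c) y v.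
Proof. by move=> /derivable_mxP/(_ 0 c). Qed.

Lemma near_eq_continuous_at (g1 g2 : 'rV[R]_m -> R) x :
  (\forall y \near x, g1 y = g2 y) ->
  {for x, continuous g1} -> {for x, continuous g2}.
Proof.
move=> g12 g1c; have E : g1 x = g2 x := nbhs_singleton g12.
rewrite /prop_for /continuous_at -E.
exact: cvg_trans (near_eq_cvg g12) g1c.
Qed.

(** [schwarz] is scalar and is applied to each coordinate g. Coordinates are known to commute with
    derivatives only on U, where f is derivable, hence the equalities near a point. *)
Lemma partialC f i j : Cn_on U 2 f ->
  eq_on (partial i (partial j f)) (partial j (partial i f)).
Proof.
move=> /Cn_onP[fc fd] x Ux; apply/rowP => c.
pose g y := f y 0 c.
have d1 y l : U y -> derivable f y (unitv l) by move=> Uy; exact: (fd [::]).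
have d2 y l l' : U y -> derivable (partial l' f) y (unitv l).
  by move=> Uy; exact: (fd [:: l']).
have pE l y : U y -> partial l f y 0 c = 'D_(unitv l) g y.
  by move=> Uy; apply: partial_coord; exact: d1.
have npE l y : U y -> \forall z \near y, partial l f z 0 c = 'D_(unitv l) g z.
  by move=> Uy; apply: filterS (near_open Uy) => z; exact: pE.
have ppE l l' y : U y -> partial l (partial l' f) y 0 c = 'D_(unitv l) ('D_(unitv l') g) y.
  move=> Uy; rewrite partial_coord; last exact: d2.
  by apply: near_eq_derive; exact: npE.
have cpp l l' : {for x, continuous ('D_(unitv l) ('D_(unitv l') g))}.
  apply: (@near_eq_continuous_at (fun y => partial l (partial l' f) y 0 c)).
    by apply: filterS (near_open Ux) => z; exact: ppE.
  have cf : {for x, continuous (partial l (partial l' f))}.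
    exact: (continuous_openP _).1 (fc [:: l; l'] isT) x Ux.
  exact: (cvg_comp _ _ cf (@coord_continuous _ _ _ 0 c _)).
apply: (etrans (ppE i j x Ux)); apply: (etrans _ (esym (ppE j i x Ux))).
apply: schwarz; [|exact: cpp|exact: cpp].
apply: filterS (near_open Ux) => y Uy; split.
- exact/derivable_coord/d1.
- exact/derivable_coord/d1.
- apply: (near_eq_derivable (npE j y Uy)); exact/derivable_coord/d2.
- apply: (near_eq_derivable (npE i y Uy)); exact/derivable_coord/d2.
Qed.

Lemma wpartial_perm w w' f : Cn_on U (size w) f -> perm_eq w w' ->
  eq_on (wpartial w f) (wpartial w' f).
Proof.
(* A letter passes w1 by adjacent swaps. Each swap applies [partialC] to the derivative along the
   remaining letters, which still has two orders left. *)
have move_front i w1 w2 : Cn_on U (size w1 + size w2).+1 f ->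
    eq_on (wpartial (i :: w1 ++ w2) f) (wpartial (w1 ++ i :: w2) f).
  elim: w1 => [|i1 w1 IH] fC x Ux; first by [].
  rewrite -[RHS](partial_eq_on _ (IH _) Ux); last exact: Cn_on_le fC.
  apply: partialC Ux; apply: (@Cn_on_partial 2 (w1 ++ w2)).
  by rewrite size_cat addn2.
elim: w w' => [|i w IH] w' fC.
  by rewrite perm_sym => /perm_nilP ->.
move=> pw; have iw' : i \in w' by rewrite -(perm_mem pw) mem_head.
case/splitPr: iw' pw => w1 w2.
rewrite perm_sym perm_catC /= perm_cons perm_catC perm_sym => pw x Ux.
rewrite -move_front => //; last by rewrite -size_cat -(perm_size pw).
apply: partial_eq_on => //; apply: IH => //.
exact: Cn_on_le fC.
Qed.

Definition word (a : mindex m) : seq 'I_m := flatten [seq nseq (a i) i | i <- enum 'I_m].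

Definition index_of w : mindex m := [ffun i => count_mem i w].

Lemma mpartialE a f : mpartial a f = wpartial (word a) f.
Proof.
rewrite /mpartial /word; elim: (enum _) => //= i s ->.
by rewrite wpartial_cat; elim: (a i) => //= j ->.
Qed.

Lemma count_word a i : count_mem i (word a) = a i.
Proof.
rewrite count_flatten -map_comp sumnE big_map big_enum /= (bigD1 i)//= big1 => [|l li].
  by rewrite count_nseq /= eqxx mul1n addn0.
by rewrite count_nseq /= (negbTE li).
Qed.

Lemma size_word a : size (word a) = mlength a.
Proof.
rewrite size_flatten /shape -map_comp sumnE big_map big_enum /=.
by apply: eq_bigr => i _; rewrite size_nseq.
Qed.

Lemma perm_word w : perm_eq w (word (index_of w)).
Proof. by apply/allP => i _ /=; rewrite count_word ffunE. Qed.

Lemma word_indexK a : index_of (word a) = a.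
Proof. by apply/ffunP => i; rewrite ffunE count_word. Qed.

Lemma mlength_index w : mlength (index_of w) = size w.
Proof. by rewrite -size_word -(perm_size (perm_word w)). Qed.

Lemma mpartial_index w f : Cn_on U (size w) f ->
  eq_on (mpartial (index_of w) f) (wpartial w f).
Proof.
move=> fC x Ux; rewrite mpartialE; apply/esym.
by apply: wpartial_perm => //; exact: perm_word.
Qed.

Lemma mpartial_eq_on a f g : eq_on f g -> eq_on (mpartial a f) (mpartial a g).
Proof. by rewrite !mpartialE; exact: wpartial_eq_on. Qed.

Lemma mpartial_continuous a f : Cn_on U (mlength a) f ->
  {within U, continuous (mpartial a f)}.
Proof. by rewrite -size_word mpartialE => /Cn_onP[+ _]; exact. Qed.

Lemma le_order_trans i j k : (i <= j)%N -> le_order j k -> le_order i k.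
Proof. by case: k => //= k; exact: leq_trans. Qed.

End OpenSmooth.

(** * Limits of smooth maps along an equicontinuous filter *)

(** Small letters belong to a map h of the filter (two values and a derivative), capitals to the
    limits. After division by t the errors add up to e/3 + e/3 + 2 (e/6) = e. *)
Lemma growth_rate_bound (R : realType) n (a b c A B C : 'rV[R]_n) (t e : R) :
  t != 0 -> `|c - C| < e / 3 -> `|a - A| < e / 6 * `|t| ->
  `|b - B| < e / 6 * `|t| -> `|b - a - t *: c| <= e / 3 * `|t| ->
  `|C - t^-1 *: (B - A)| <= e.
Proof.
move=> t0 cC aA bB bac; have nt0 : 0 < `|t| by rewrite normr_gt0.
have -> : C - t^-1 *: (B - A) = t^-1 *:
    (- (t *: (c - C)) - (b - a - t *: c) + ((b - B) - (a - A))).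
  by apply/rowP => j; rewrite !mxE; field.
rewrite normrZ normfV mulrC ler_pdivrMr//.
have tcC : `|t *: (c - C)| <= e / 3 * `|t|.
  by rewrite normrZ mulrC ler_wpM2r// ltW.
rewrite (le_trans (ler_normD _ _))//.
rewrite (le_trans (lerD (ler_normB _ _) (ler_normB _ _)))// normrN.
move: aA bB bac tcC; move: `|t| `|a - A| `|b - B| `|b - a - t *: c| `|t *: (c - C)|.
move=> s p q r o; nra.
Qed.

Section FilterLimit.
Context (R : realType) (m n : nat) (U : set 'rV[R]_m) (hU : open U).
Local Notation map := ('rV[R]_m -> 'rV[R]_n).
Local Notation unitv i := (delta_mx 0 i : 'rV[R]_m).
Context (k : option nat) (F : set_system map) {FF : ProperFilter F}.
Context (v : mindex m -> map).
Hypothesis F_Ck : F (Ck_on U k).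
Hypothesis F_cvg : forall a, le_order (mlength a) k -> forall x, U x ->
  forall e : R, 0 < e -> F [set h | `|mpartial a h x - v a x| < e].
Hypothesis F_equicontinuous : forall a, le_order (mlength a) k -> forall x, U x ->
  forall e : R, 0 < e -> exists2 d : R, 0 < d & F [set h | forall y, U y ->
    `|y - x| < d -> `|mpartial a h y - mpartial a h x| < e].

(** The hypotheses speak of multi-indices, but differentiating once more prepends a letter in any
    position of the order; words make that induction possible. *)
Let vw (w : seq 'I_m) : map := v (index_of w).

Let F_word w : le_order (size w) k ->
  F [set h | eq_on U (mpartial (index_of w) h) (wpartial w h)].
Proof.
move=> wk; apply: filterS F_Ck => h /(_ _ wk) hC.
exact: mpartial_index.
Qed.

Let Fw_cvg w : le_order (size w) k -> forall x, U x ->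
  forall e : R, 0 < e -> F [set h | `|wpartial w h x - vw w x| < e].
Proof.
move=> wk x Ux e e0; have wk' := wk; rewrite -mlength_index in wk'.
by apply: filterS2 (F_word wk) (F_cvg wk' Ux e0) => h /= /(_ x Ux) ->.
Qed.

Let Fw_equicontinuous w : le_order (size w) k -> forall x, U x ->
  forall e : R, 0 < e -> exists2 d : R, 0 < d & F [set h | forall y, U y ->
    `|y - x| < d -> `|wpartial w h y - wpartial w h x| < e].
Proof.
move=> wk x Ux e e0; have wk' := wk; rewrite -mlength_index in wk'.
have [d d0 Fd] := F_equicontinuous wk' Ux e0; exists d => //.
apply: filterS2 (F_word wk) Fd => h /= hE hd y Uy yx.
by rewrite -hE// -hE//; exact: hd.
Qed.

Let vw_continuous w : le_order (size w) k -> {within U, continuous (vw w)}.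
Proof.
move=> wk; apply/(continuous_openP hU) => x Ux.
apply: (@cvgrPdist_le _ _ _ (nbhs x) (nbhs_filter x) (vw w) (vw w x)).2 => e e0.
have e3 : 0 < e / 3 by rewrite divr_gt0.
have [d d0 Fd] := Fw_equicontinuous wk Ux e3.
have nearU := near_open hU Ux.
have near_d : \forall y \near x, `|y - x| < d.
  by apply/nbhs_ballP; exists d => // y; rewrite -ball_normE /ball_ /= distrC.
near=> y.
have Uy : U y by near: y.
have yx : `|y - x| < d by near: y.
(* [h] is chosen after [y], so pointwise convergence at x and y is enough; only [d] had to be
   uniform. *)
have [h [[h1 h2] h3]] := filter_ex
  (filterI (filterI (Fw_cvg wk Ux e3) (Fw_cvg wk Uy e3)) Fd).
have {}h3 := h3 y Uy yx; move: h1 h2 h3 => /=.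
move: (wpartial w h x) (wpartial w h y) (vw w x) (vw w y) => a b c d' h1 h2 h3.
have -> : c - d' = - (a - c) + (b - d') - (b - a).
  by apply/rowP => j; rewrite !mxE; ring.
rewrite (le_trans (ler_normB _ _))// (le_trans (lerD (ler_normD _ _) (lexx _)))//.
rewrite normrN; lra.
Unshelve. all: by end_near. Qed.

Let vw_growth w i x : le_order (size w).+1 k -> U x ->
  (fun t => t^-1 *: (vw w (t *: unitv i + x) - vw w x)) @ 0^' --> vw (i :: w) x.
Proof.
move=> wk Ux; have wk' : le_order (size w) k by apply: le_order_trans wk.
apply/cvgrPdist_le => e e0.
have e3 : 0 < e / 3 by rewrite divr_gt0.
have [d d0 Fd] := Fw_equicontinuous (w := i :: w) wk Ux e3.
have /nbhs_ballP[r /= r0 rU] := near_open hU Ux.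
have nu t : `|t *: unitv i| <= `|t|.
  rewrite normrZ ler_piMr//; apply: mx_norm_le => // p q.
  by rewrite mxE; case: (_ && _); rewrite ?normr1 ?normr0.
have near0 : \forall t \near (0 : R)^', [/\ t != 0, `|t| < d & `|t| < r].
  near=> t0; split; near: t0.
  - exact: nbhs_dnbhs_neq.
  - exact: dnbhs0_lt.
  - exact: dnbhs0_lt.
near=> t; have [t0 td tr] : [/\ t != 0, `|t| < d & `|t| < r] by near: t.
have Ut s : `|s| <= `|t| -> U (x + s *: unitv i).
  move=> st; apply: rU; rewrite -ball_normE /ball_ /= opprD addNKr normrN.
  exact: le_lt_trans (nu s) (le_lt_trans st tr).
have Uxt := Ut t (lexx _).
(* Since h is picked after t, its values at both ends of the step may be required to a precision
   proportional to |t|, which survives the division by t. *)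
have et : 0 < e / 6 * `|t| by rewrite mulr_gt0 ?divr_gt0 ?normr_gt0.
have [h [[[hC h1] [h2 h3]] h4]] := filter_ex (filterI (filterI (filterI F_Ck (Fw_cvg (w := i :: w) wk Ux e3))
    (filterI (Fw_cvg wk' Ux et) (Fw_cvg wk' Uxt et))) Fd).
have /Cn_onP[_ hd] := hC _ wk.
have dE s : `|s| <= `|t| -> `|x + s *: unitv i - x| < d.
  move=> st; rewrite addrC addKr.
  exact: le_lt_trans (nu s) (le_lt_trans st td).
have mvt := MVT_line_mx (fun s st => hd w i _ (ltnSn _) (Ut s st))
  (fun s st => ltW (h4 _ (Ut s st) (dE s st))).
rewrite (addrC _ x); exact: growth_rate_bound t0 h1 h2 h3 mvt.
Unshelve. all: by end_near. Qed.

Let vw_derivable w i x : le_order (size w).+1 k -> U x ->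
  derivable (vw w) x (unitv i).
Proof. by move=> wk Ux; apply: cvgP; exact: vw_growth. Qed.

Let vw_partial w i : le_order (size w).+1 k ->
  eq_on U (partial i (vw w)) (vw (i :: w)).
Proof. by move=> wk x Ux; apply: cvg_lim => //; exact: vw_growth. Qed.

Let vw_nil_partial w : le_order (size w) k ->
  eq_on U (wpartial w (vw [::])) (vw w).
Proof.
elim: w => // i w IH wk x Ux.
rewrite -(vw_partial i wk Ux); apply: (partial_eq_on hU) Ux.
by apply: IH; apply: le_order_trans wk.
Qed.

Lemma filter_limit_Ck : Ck_on U k (v [ffun=> 0%N]) /\
  forall a, le_order (mlength a) k -> eq_on U (mpartial a (v [ffun=> 0%N])) (v a).
Proof.
have -> : v [ffun=> 0%N] = vw [::] by congr v; apply/ffunP => i; rewrite !ffunE.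
have Ck : Ck_on U k (vw [::]).
  move=> j jk; apply/Cn_onP; split=> [w wj|w i x wj Ux].
    have wk := le_order_trans wj jk.
    by apply: within_continuous_eq_on (vw_continuous wk); exact/eq_on_sym/vw_nil_partial.
  have wk := le_order_trans wj jk.
  apply: (derivable_eq_on hU _ Ux (vw_derivable wk Ux)).
  by apply/eq_on_sym/vw_nil_partial; apply: le_order_trans wk.
split=> // a ak x Ux; rewrite mpartialE vw_nil_partial ?size_word//.
by rewrite /vw word_indexK.
Qed.

End FilterLimit.

(** * Codes of standard objects and their members *)

Section Codes.
Context (R : realType) (V : superstructure R).
Implicit Types (c d : V).

Notation level := (level (@atom R V) (@elem R V)).

Lemma injective_atom : injective (@atom R V).
Proof. by move=> x y; exact: atom_inj. Qed.

Lemma level_atom (r : R) : level 0 (@atom _ V r).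
Proof. by exists r. Qed.

Lemma elem_base c : elem c (base V) <-> exists r, c = atom r.
Proof.
rewrite elem_setofE; last by exists 0%N.
by split=> [[r _ <-]|[r ->]]; exists r.
Qed.

(** The ranks 2, 3, 5, 6, 7, 8 in this section come from counting: a pair adds two levels and
    [setof] adds one. Any finite bound would do. *)
Lemma level_vec_elem n (x : 'rV[R]_n) :
  [set opair (atom i%:R) (atom (x 0 i)) | i in [set: 'I_n]] `<=` level 2.
Proof. by move=> _ [i _ <-]; apply: level_opair; exact: level_atom. Qed.

Lemma level_vec n (x : 'rV[R]_n) : level 3 (vec V x).
Proof. exact/level_setof/level_vec_elem. Qed.

Lemma vec_inj n : injective (@vec R V n).
Proof.
move=> x y xy; apply/rowP => i.
have : elem (opair (atom i%:R) (atom (x 0 i))) (vec V x).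
  by rewrite elem_setofE; [exists i|exists 2%N; exact: level_vec_elem].
rewrite xy elem_setofE; last by exists 2%N; exact: level_vec_elem.
move=> [j _ /opair_inj[/injective_atom ji /injective_atom <-]].
by move/eqP: ji; rewrite eqr_nat => /eqP/val_inj ->.
Qed.

Lemma elem_Rn n c : elem c (Rn V n) <-> exists x : 'rV[R]_n, c = vec V x.
Proof.
rewrite elem_setofE; last by exists 3%N => _ [x _ <-]; exact: level_vec.
by split=> [[x _ <-]|[x ->]]; exists x.
Qed.

Lemma elem_subset_code m (U : set 'rV[R]_m) c :
  elem c (subset_code V U) <-> exists2 x, U x & c = vec V x.
Proof.
rewrite elem_setofE; last by exists 3%N => _ [x _ <-]; exact: level_vec.
by split=> [[x Ux <-]|[x Ux ->]]; exists x.
Qed.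

Lemma elem_ltR c : elem c (ltR V) <->
  exists x y : R, x < y /\ c = opair (atom x) (atom y).
Proof.
rewrite elem_setofE//; exists 2%N => _ [x [y [_ ->]]].
by apply: level_opair; exact: level_atom.
Qed.

Lemma elem_ltR_opair (x y : R) : elem (opair (atom x) (atom y)) (ltR V) <-> x < y.
Proof.
rewrite elem_ltR; split=> [[x' [y' [xy /opair_inj[/injective_atom -> /injective_atom ->]]]]//|xy].
by exists x, y.
Qed.

Lemma level_vec2 m n (x : 'rV[R]_m) (y : 'rV[R]_n) : level 5 (opair (vec V x) (vec V y)).
Proof. by apply: level_opair; exact: level_vec. Qed.

Lemma level_dist n (x y : 'rV[R]_n) (r : R) :
  level 7 (opair (opair (vec V x) (vec V y)) (atom r)).
Proof.
by apply: level_opair; [exact: level_vec2|exact: level_le (level_atom r)].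
Qed.

Lemma elem_dist n c : elem c (dist V n) <-> exists x y : 'rV[R]_n,
  c = opair (opair (vec V x) (vec V y)) (atom `|x - y|).
Proof.
by rewrite elem_setofE//; exists 7%N => _ [x [y ->]]; exact: level_dist.
Qed.

Definition Rn2 n : V := setof [set p | exists x y : 'rV[R]_n,
  p = opair (vec V x) (vec V y)].

Lemma elem_Rn2 n c : elem c (Rn2 n) <-> exists x y : 'rV[R]_n,
  c = opair (vec V x) (vec V y).
Proof.
by rewrite elem_setofE//; exists 5%N => _ [x [y ->]]; exact: level_vec2.
Qed.

(** One relation for each standard e. With it the triangle inequality transfers without coding the
    addition of the reals. *)
Definition near_code n (e : R) : V := setof [set p | exists x y : 'rV[R]_n,
  `|x - y| < e /\ p = opair (vec V x) (vec V y)].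

Lemma elem_near_code n (e : R) (x y : 'rV[R]_n) :
  elem (opair (vec V x) (vec V y)) (near_code n e) <-> `|x - y| < e.
Proof.
rewrite elem_setofE; last by exists 5%N => _ [x' [y' [_ ->]]]; exact: level_vec2.
by split=> [[x' [y' [xy /opair_inj[/vec_inj -> /vec_inj ->]]]]|xy] //; exists x, y.
Qed.

Lemma isfun_dist n : isfun (dist V n) (Rn2 n) (base V).
Proof.
split.
- move=> p /elem_dist[x [y ->]]; exists (opair (vec V x) (vec V y)).
  split; first by apply/elem_Rn2; exists x, y.
  by exists (atom `|x - y|); split=> //; apply/elem_base; exists `|x - y|.
- move=> p /elem_Rn2[x [y ->]]; exists (atom `|x - y|).
  split; first by apply/elem_base; exists `|x - y|.
  by apply/elem_dist; exists x, y.
- move=> p t t' /elem_dist[x [y /opair_inj[-> ->]]] /elem_dist[x' [y']].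
  by move=> /opair_inj[/opair_inj[/vec_inj -> /vec_inj ->] ->].
Qed.

Section Graphs.
Context (m n : nat) (U : set 'rV[R]_m) (hU : open U).
Implicit Types f g : 'rV[R]_m -> 'rV[R]_n.

Lemma elem_graph f c : elem c (graph V U f) <->
  exists2 x, U x & c = opair (vec V x) (vec V (f x)).
Proof.
rewrite elem_setofE; last by exists 5%N => _ [x _ <-]; exact: level_vec2.
by split=> [[x Ux <-]|[x Ux ->]]; exists x.
Qed.

Lemma elem_graph_opair f x c :
  elem (opair (vec V x) c) (graph V U f) <-> U x /\ c = vec V (f x).
Proof.
rewrite elem_graph; split=> [[y Uy /opair_inj[/vec_inj -> ->]] //|[Ux ->]].
by exists x.
Qed.

Lemma level_graph f : level 6 (graph V U f).
Proof. by apply: level_setof => _ [x _ <-]; exact: level_vec2. Qed.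

Lemma graph_not_atom f : ~ range atom (graph V U f).
Proof. by apply: (@setof_not_atom _ _ 5) => _ [x _ <-]; exact: level_vec2. Qed.

Lemma eq_graph f g : graph V U f = graph V U g <-> eq_on U f g.
Proof.
split=> [fg x Ux|fg].
  have : elem (opair (vec V x) (vec V (f x))) (graph V U g).
    by rewrite -fg elem_graph_opair.
  by rewrite elem_graph_opair => -[_ /vec_inj].
apply: set_ext => [||c]; try exact: graph_not_atom.
by rewrite !elem_graph; split=> -[x Ux ->]; exists x => //; rewrite fg.
Qed.

Lemma isfun_graph f : isfun (graph V U f) (subset_code V U) (Rn V n).
Proof.
split.
- move=> p /elem_graph[x Ux ->]; exists (vec V x).
  split; first by apply/elem_subset_code; exists x.
  by exists (vec V (f x)); split=> //; apply/elem_Rn; exists (f x).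
- move=> _ /elem_subset_code[x Ux ->]; exists (vec V (f x)).
  split; first by apply/elem_Rn; exists (f x).
  by rewrite elem_graph_opair.
- move=> p y y' /elem_graph[x Ux /opair_inj[-> ->]].
  by rewrite elem_graph_opair => -[_ ->].
Qed.

Definition map_code : V := setof (range (@graph R V m n U)).

Lemma elem_map_code c : elem c map_code <-> exists f, c = graph V U f.
Proof.
rewrite elem_setofE; last by exists 6%N => _ [f _ <-]; exact: level_graph.
by split=> [[f _ <-]|[f ->]]; exists f.
Qed.

Definition set_code (A : set ('rV[R]_m -> 'rV[R]_n)) : V := setof (graph V U @` A).

Lemma elem_set_code A c : elem c (set_code A) <-> exists2 f, A f & c = graph V U f.
Proof.
rewrite elem_setofE; last by exists 6%N => _ [f _ <-]; exact: level_graph.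
by split=> [[f Af <-]|[f Af ->]]; exists f.
Qed.

Lemma elem_Ck_code k c :
  elem c (Ck_code V n U k) <-> exists2 f : 'rV[R]_m -> 'rV[R]_n, Ck_on U k f & c = graph V U f.
Proof. exact: elem_set_code. Qed.

Lemma elem_mpartial_code a c : elem c (mpartial_code V n U a) <->
  exists2 f : 'rV[R]_m -> 'rV[R]_n, Ck_on U (Some (mlength a)) f &
    c = opair (graph V U f) (graph V U (mpartial a f)).
Proof.
rewrite elem_setofE; last first.
  by exists 8%N => _ [f _ <-]; apply: level_opair; exact: level_graph.
by split=> [[f fa <-]|[f fa ->]]; exists f.
Qed.

(** The coded operator is single-valued: maps with the same graph agree on the open set U, hence so
    do their derivatives there. *)
Lemma elem_mpartial_code_opair a f c : Ck_on U (Some (mlength a)) f ->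
  elem (opair (graph V U f) c) (mpartial_code V n U a) <->
  c = graph V U (mpartial a f).
Proof.
move=> fa; rewrite elem_mpartial_code; split; last by move=> ->; exists f.
move=> [g ga /opair_inj[/eq_graph fg ->]]; apply/eq_graph.
by apply: (mpartial_eq_on hU); exact: eq_on_sym.
Qed.

Lemma isfun_mpartial_code a : isfun (mpartial_code V n U a)
  (Ck_code V n U (Some (mlength a))) map_code.
Proof.
split.
- move=> p /elem_mpartial_code[f fa ->]; exists (graph V U f).
  split; first by apply/elem_Ck_code; exists f.
  exists (graph V U (mpartial a f)); split=> //.
  by apply/elem_map_code; exists (mpartial a f).
- move=> _ /elem_Ck_code[f fa ->]; exists (graph V U (mpartial a f)).
  split; first by apply/elem_map_code; exists (mpartial a f).
  exact/elem_mpartial_code_opair.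
- move=> p y y' /elem_mpartial_code[f fa /opair_inj[-> ->]].
  by rewrite elem_mpartial_code_opair.
Qed.

Lemma Ck_on_mlength k (a : mindex m) f : le_order (mlength a) k ->
  Ck_on U k f -> Ck_on U (Some (mlength a)) f.
Proof. by move=> ak fk j ja; apply: fk; exact: le_order_trans ja ak. Qed.

End Graphs.

(** Its star consists of internal subsets of *U, so transferring an existence statement over it
    yields internal sets defined by a formula. *)
Definition pow_code m (U : set 'rV[R]_m) : V :=
  setof [set subset_code V A | A in [set A | A `<=` U]].

Lemma elem_pow_code m (U : set 'rV[R]_m) c :
  elem c (pow_code U) <-> exists2 A, A `<=` U & c = subset_code V A.
Proof.
rewrite elem_setofE; first by split=> [[A AU <-]|[A AU ->]]; exists A.
by exists 4%N => _ [A _ <-]; apply: level_setof => _ [x _ <-]; exact: level_vec.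
Qed.

Lemma elem_subset_code_vec m (A : set 'rV[R]_m) x :
  elem (vec V x) (subset_code V A) <-> A x.
Proof.
rewrite elem_subset_code; split=> [[y Ay /vec_inj ->]//|Ax]; by exists x.
Qed.

End Codes.

(** * Infinite closeness and internal maps by transfer *)

Section Star.
Context (R : realType) (Y : Type) (V : superstructure R) (W : superstructure Y).
Context (ns : nonstandard_extension V W).
Implicit Types (a b c x y : V) (e d : R).

Lemma star_elem a b : elem a b -> elem (ns a) (ns b).
Proof. exact: (xtransfer ns (XMem 0 1) (env a [:: a; b])).1. Qed.

Lemma star_opair a b : ns (opair a b) = opair (ns a) (ns b).
Proof. exact: (xtransfer ns (XPair 0 1 2) (env a [:: opair a b; a; b])).1 erefl. Qed.

Lemma star_isfun f a b : isfun f a b -> isfun (ns f) (ns a) (ns b).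
Proof. exact: (xtransfer ns (XFun 0 1 2) (env a [:: f; a; b])).1. Qed.

Lemma star_subset a b : (forall c, elem c a -> elem c b) ->
  forall c : W, elem c (ns a) -> elem c (ns b).
Proof.
exact: (xtransfer ns (XAll 2 0 (XMem 2 1)) (env a [:: a; b])).1.
Qed.

Section Near.
Context (n : nat).

Definition snear e (a b : W) := elem (opair a b) (ns (near_code V n e)).

Lemma star_vec (x : 'rV[R]_n) : elem (ns (vec V x)) (ns (Rn V n)).
Proof. by apply: star_elem; apply/elem_Rn; exists x. Qed.

Lemma snear_refl e (a : W) : 0 < e -> elem a (ns (Rn V n)) -> snear e a a.
Proof.
move=> e0; apply: (xtransfer ns (XAll 2 0 (XPMem 2 2 1))
  (env (Rn V n) [:: Rn V n; near_code V n e])).1 => /=.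
by move=> _ /elem_Rn[x ->]; rewrite elem_near_code subrr normr0.
Qed.

Lemma snear_sym e (a b : W) : elem a (ns (Rn V n)) -> elem b (ns (Rn V n)) ->
  snear e a b -> snear e b a.
Proof.
move=> aR; move: b; move: a aR.
apply: (xtransfer ns (XAll 2 0 (XAll 3 0 (XImp (XPMem 2 3 1) (XPMem 3 2 1))))
  (env (Rn V n) [:: Rn V n; near_code V n e])).1 => /=.
move=> _ /elem_Rn[x ->] _ /elem_Rn[y ->].
by rewrite !elem_near_code distrC.
Qed.

Lemma snear_trans e d (a b c : W) : elem a (ns (Rn V n)) ->
  elem b (ns (Rn V n)) -> elem c (ns (Rn V n)) ->
  snear e a b -> snear d b c -> snear (e + d) a c.
Proof.
move=> aR bR; move: c; move: b bR; move: a aR.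
apply: (xtransfer ns (XAll 4 0 (XAll 5 0 (XAll 6 0
    (XImp (XPMem 4 5 1) (XImp (XPMem 5 6 2) (XPMem 4 6 3))))))
  (env (Rn V n) [:: Rn V n; near_code V n e; near_code V n d; near_code V n (e + d)])).1 => /=.
move=> _ /elem_Rn[x ->] _ /elem_Rn[y ->] _ /elem_Rn[z ->].
rewrite !elem_near_code => xy yz.
exact: le_lt_trans (ler_distD y _ _) (ltrD xy yz).
Qed.

Lemma snear_le e d (a b : W) : elem a (ns (Rn V n)) -> elem b (ns (Rn V n)) ->
  e <= d -> snear e a b -> snear d a b.
Proof.
move=> aR bR ed; move: b bR; move: a aR.
apply: (xtransfer ns (XAll 3 0 (XAll 4 0 (XImp (XPMem 3 4 1) (XPMem 3 4 2))))
  (env (Rn V n) [:: Rn V n; near_code V n e; near_code V n d])).1 => /=.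
move=> _ /elem_Rn[x ->] _ /elem_Rn[y ->].
by rewrite !elem_near_code => /lt_le_trans; apply.
Qed.

Lemma infcloseP (a b : W) : elem a (ns (Rn V n)) -> elem b (ns (Rn V n)) ->
  infclose ns n a b <-> forall e, 0 < e -> snear e a b.
Proof.
move=> aR bR.
have abR : elem (opair a b) (ns (Rn2 V n)).
  have [] : exists p, elem p (ns (Rn2 V n)) /\ p = opair a b; last by move=> p [+ <-].
  move: b bR; move: a aR.
  apply: (xtransfer ns (XAll 2 0 (XAll 3 0 (XEx 4 1 (XPair 4 2 3))))
    (env (Rn V n) [:: Rn V n; Rn2 V n])).1 => /=.
  move=> _ /elem_Rn[x ->] _ /elem_Rn[y ->].
  by exists (opair (vec V x) (vec V y)); split=> //; apply/elem_Rn2; exists x, y.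
have [tD tB] := isfun_appP (star_isfun (isfun_dist V n)) abR.
(* For one standard e this is a bounded statement, and -e < t is automatic because t is a distance.
   The quantifier over e stays outside the transfer: it ranges over standard reals only. *)
have key e : (elem (opair (ns (atom (- e))) (app (ns (dist V n)) (opair a b))) (ns (ltR V)) /\
    elem (opair (app (ns (dist V n)) (opair a b)) (ns (atom e))) (ns (ltR V))) <->
    snear e a b.
  move: (app _ _) tB tD; rewrite /snear; move: (opair a b) abR.
  apply: (xtransfer ns (XAll 7 0 (XAll 8 1 (XImp (XPMem 7 8 2)
     (XIff (XAnd (XPMem 4 8 3) (XPMem 8 5 3)) (XMem 7 6)))))
    (env (Rn V n) [:: Rn2 V n; base V; dist V n; ltR V; atom (- e); atom e;
       near_code V n e])).1 => /=.
  move=> _ /elem_Rn2[x [y ->]] t _ /elem_dist[x' [y' /opair_inj[/opair_inj[]]]].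
  move=> /vec_inj <- /vec_inj <- ->.
  rewrite !elem_ltR_opair elem_near_code.
  split=> [[_ //]|h]; split=> //; rewrite (lt_le_trans _ (normr_ge0 _))//.
  by rewrite oppr_lt0 (le_lt_trans (normr_ge0 _) h).
by split=> h e e0; [apply/key/h|apply: (key e).2; exact: h].
Qed.

Lemma infclose_refl (a : W) : elem a (ns (Rn V n)) -> infclose ns n a a.
Proof. by move=> aR; apply/infcloseP => // e e0; exact: snear_refl. Qed.

Lemma infclose_sym (a b : W) : elem a (ns (Rn V n)) -> elem b (ns (Rn V n)) ->
  infclose ns n a b -> infclose ns n b a.
Proof.
move=> aR bR /(infcloseP aR bR) ab; apply/infcloseP => // e e0.
by apply: snear_sym => //; exact: ab.
Qed.

Lemma infclose_trans (b a c : W) : elem a (ns (Rn V n)) ->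
  elem b (ns (Rn V n)) -> elem c (ns (Rn V n)) ->
  infclose ns n a b -> infclose ns n b c -> infclose ns n a c.
Proof.
move=> aR bR cR /(infcloseP aR bR) ab /(infcloseP bR cR) bc.
apply/infcloseP => // e e0; rewrite (splitr e).
by apply: (snear_trans aR bR cR); [apply: ab|apply: bc]; rewrite divr_gt0.
Qed.

Lemma infclose_st (a : W) : nearstandard ns n a ->
  infclose ns n a (ns (vec V (st ns n a))).
Proof. move=> [_ [y ay]].
exact: (@xgetPex _ 0 [set y : 'rV[R]_n | infclose ns n a (ns (vec V y))] (ex_intro _ y ay)). Qed.

End Near.

Section Maps.
Context (m n : nat) (U : set 'rV[R]_m) (hU : open U).
Implicit Types (f g : 'rV[R]_m -> 'rV[R]_n).

Lemma star_U_Rn (xi : W) : elem xi (ns (subset_code V U)) -> elem xi (ns (Rn V m)).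
Proof.
apply: star_subset => _ /elem_subset_code[x _ ->].
by apply/elem_Rn; exists x.
Qed.

Lemma star_vec_U (x : 'rV[R]_m) : U x -> elem (ns (vec V x)) (ns (subset_code V U)).
Proof. by move=> Ux; apply: star_elem; apply/elem_subset_code; exists x. Qed.

Lemma nes_vec (x : 'rV[R]_m) : U x -> nes ns U (ns (vec V x)).
Proof.
move=> Ux; split; first exact: star_vec_U.
by exists x => //; apply: infclose_refl; exact: star_vec.
Qed.

Lemma internal_map (w : W) : elem w (ns (map_code V n U)) ->
  isfun w (ns (subset_code V U)) (ns (Rn V n)).
Proof.
move: w; apply: (xtransfer ns (XAll 3 0 (XFun 3 1 2))
  (env (Rn V n) [:: map_code V n U; subset_code V U; Rn V n])).1 => /=.
by move=> _ /elem_map_code[f ->]; exact: isfun_graph.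
Qed.

Lemma internal_map_val (w xi : W) : elem w (ns (map_code V n U)) ->
  elem xi (ns (subset_code V U)) -> elem (app w xi) (ns (Rn V n)).
Proof. by move=> /internal_map wf /(isfun_appP wf)[]. Qed.

Lemma star_graph_map f : elem (ns (graph V U f)) (ns (map_code V n U)).
Proof. by apply: star_elem; apply/elem_map_code; exists f. Qed.

Lemma ipartialP k (a : mindex m) (w : W) : le_order (mlength a) k ->
  elem w (ns (Ck_code V n U k)) ->
  elem (opair w (ipartial ns n U a w)) (ns (mpartial_code V n U a)) /\
  elem (ipartial ns n U a w) (ns (map_code V n U)).
Proof.
move=> ak wk; have wa : elem w (ns (Ck_code V n U (Some (mlength a)))).
  apply: (@star_subset _ _ _ _ wk) => _ /elem_Ck_code[f fk ->].
  by apply/elem_Ck_code; exists f => //; exact: Ck_on_mlength fk.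
exact: isfun_appP (star_isfun (isfun_mpartial_code V n hU a)) wa.
Qed.

Lemma ipartial_star_graph (a : mindex m) f : Ck_on U (Some (mlength a)) f ->
  ipartial ns n U a (ns (graph V U f)) = ns (graph V U (mpartial a f)).
Proof.
move=> fa; have ga : elem (graph V U f) (Ck_code V n U (Some (mlength a))).
  by apply/elem_Ck_code; exists f.
apply/esym/(isfun_app _ (star_isfun (isfun_mpartial_code V n hU a)) (star_elem ga)).
by rewrite -star_opair; apply: star_elem; exact/elem_mpartial_code_opair.
Qed.

Lemma mlength0 : mlength ([ffun=> 0%N] : mindex m) = 0%N.
Proof. by rewrite /mlength big1// => i _; rewrite ffunE. Qed.

Lemma mpartial0 f : mpartial [ffun=> 0%N] f = f.
Proof.
rewrite mpartialE; suff -> : word ([ffun=> 0%N] : mindex m) = [::] by [].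
by apply/nilP; rewrite /nilp size_word mlength0.
Qed.

(** Lets the [SC] condition at the zero multi-index be read as S-continuity of w itself. *)
Lemma ipartial0 k (w : W) : elem w (ns (Ck_code V n U k)) ->
  ipartial ns n U [ffun=> 0%N] w = w.
Proof.
move=> wk; have a0 : le_order (mlength ([ffun=> 0%N] : mindex m)) k.
  by rewrite mlength0; case: (k).
have w0 : elem w (ns (Ck_code V n U (Some (mlength ([ffun=> 0%N] : mindex m))))).
  apply: (@star_subset _ _ _ _ wk) => _ /elem_Ck_code[f fk ->].
  by apply/elem_Ck_code; exists f => //; exact: Ck_on_mlength fk.
apply/esym/(isfun_app _ (star_isfun (isfun_mpartial_code V n hU _)) w0).
move: w {w0} wk; apply: (xtransfer ns (XAll 2 0 (XPMem 2 2 1))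
  (env (Rn V n) [:: Ck_code V n U k; mpartial_code V n U [ffun=> 0%N]])).1 => /=.
move=> _ /elem_Ck_code[f fk ->]; rewrite elem_mpartial_code_opair ?mpartial0//.
exact: Ck_on_mlength fk.
Qed.

End Maps.
End Star.

(** * S-continuity, the filter of an internal map, and its standard part *)

Section InternalMaps.
Context (R : realType) (Y : Type) (V : superstructure R) (W : superstructure Y).
Context (ns : nonstandard_extension V W).
Context (m n : nat) (U : set 'rV[R]_m) (hU : open U).
Implicit Types (f g h : 'rV[R]_m -> 'rV[R]_n) (w xi : W) (x y : 'rV[R]_m).

Local Notation snear := (snear ns).
Local Notation sU := (ns (subset_code V U)).

(** These are the points that violate the modulus d for e. Saturation applies to internal sets only,
    so they are produced by transfer over [pow_code]; as [app] is not in the formula language,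
    values of w enter as u, v paired with their arguments in w. *)
Lemma bad_set_internal w x (d e : R) : elem w (ns (map_code V n U)) -> U x ->
  exists S, [/\ internal ns S, (forall xi, elem xi S -> elem xi sU) &
    forall xi, elem xi sU -> elem xi S <->
      snear m d xi (ns (vec V x)) /\
      ~ snear n e (app w xi) (app w (ns (vec V x)))].
Proof.
move=> wmap Ux.
have [S [SP SE]] : exists S, elem S (ns (pow_code V U)) /\
  forall xi, elem xi sU -> elem xi S <->
    snear m d xi (ns (vec V x)) /\
    ~ (forall u, elem u (ns (Rn V n)) -> forall v, elem v (ns (Rn V n)) ->
       elem (opair xi u) w -> elem (opair (ns (vec V x)) v) w -> snear n e u v).
  move: w wmap; apply: (xtransfer ns (XAll 7 0 (XEx 8 1 (XAll 9 2
    (XIff (XMem 9 8) (XAnd (XPMem 9 3 5)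
     (XNot (XAll 10 4 (XAll 11 4 (XImp (XPMem 9 10 7) (XImp (XPMem 3 11 7)
       (XPMem 10 11 6))))))))))) (env (Rn V n) [:: map_code V n U; pow_code V U;
      subset_code V U; vec V x; Rn V n; near_code V m d; near_code V n e])).1 => /=.
  move=> _ /elem_map_code[f ->].
  exists (subset_code V [set y | [/\ U y, `|y - x| < d & ~ `|f y - f x| < e]]).
  split; first by apply/elem_pow_code; eexists; [|reflexivity]; move=> y [].
  move=> _ /elem_subset_code[y Uy ->]; rewrite elem_subset_code_vec elem_near_code.
  split.
    move=> [_ yx nfe]; split=> // h; apply: nfe; apply/(elem_near_code V).
    apply: h; try by apply/elem_graph_opair.
      by apply/elem_Rn; exists (f y).
    by apply/elem_Rn; exists (f x).
  move=> [yx nfe]; split=> // fe; apply: nfe.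
  by move=> u _ v _ /elem_graph_opair[_ ->] /elem_graph_opair[_ ->]; apply/elem_near_code.
exists S; split; first by exists (pow_code V U).
  move: S SP {SE}; apply: (xtransfer ns (XAll 2 0 (XAll 3 2 (XMem 3 1)))
    (env (Rn V n) [:: pow_code V U; subset_code V U])).1 => /=.
  move=> _ /elem_pow_code[A AU ->] _ /elem_subset_code[y Ay ->].
  by apply/elem_subset_code; exists y => //; exact: AU.
move=> xi xiU; rewrite (SE _ xiU).
have wf := internal_map wmap; have xU := star_vec_U ns Ux.
split=> -[h1 h2]; split=> // h3; apply: h2.
  by move=> u _ v _ /(isfun_app _ wf xiU) -> /(isfun_app _ wf xU) ->.
have [h4 h5] := isfun_appP wf xiU; have [h6 h7] := isfun_appP wf xU.
exact: h3.
Qed.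

(* S-continuity quantifies over infinitesimal distances only; saturation turns
   it into a standard modulus of continuity. *)
Lemma SC0_modulus w x (e : R) : saturated ns nat -> SC0 ns n U w ->
  elem w (ns (map_code V n U)) -> U x -> 0 < e ->
  exists2 d : R, 0 < d & forall xi, elem xi sU -> snear m d xi (ns (vec V x)) ->
    snear n e (app w xi) (app w (ns (vec V x))).
Proof.
move=> sat [wns wc] wmap Ux e0; apply: contrapT => nd.
have bad d : 0 < d -> exists xi, [/\ elem xi sU, snear m d xi (ns (vec V x)) &
    ~ snear n e (app w xi) (app w (ns (vec V x)))].
  move=> d0; apply: contrapT => nxi; apply: nd; exists d => // xi xiU xix.
  by apply: contrapT => nw; apply: nxi; exists xi.
pose d (j : nat) : R := j.+1%:R^-1.
have d0 j : 0 < d j by rewrite invr_gt0.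
have [A AP] := choice (fun j => bad_set_internal (d j) e wmap Ux).
have [|D finD|xi xiA] := sat A; first by move=> j; have [] := AP j.
  (* The bad sets decrease with j, so a bad point for the largest index of D lies in all of them. *)
  have [M DM] : exists M, forall i, D i -> (i <= M)%N.
    have /finite_seqP[s ->] := finD.
    exists (\max_(i <- s) i)%N => i /= iX.
    exact: (@leq_bigmax_seq _ s xpredT id i iX isT).
  have [xi [xiU xix nw]] := bad _ (d0 M).
  exists xi => i /DM iM; have [_ _ ->//] := AP i; split=> //.
  apply: snear_le xix; [exact: (star_U_Rn xiU)|exact: star_vec|].
  by rewrite lef_pV2 ?posrE// ler_nat.
have AU (j : nat) : elem xi sU by have [_ + _] := AP j; apply.
have xiE (j : nat) : snear m (d j) xi (ns (vec V x)) /\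
    ~ snear n e (app w xi) (app w (ns (vec V x))).
  by have [_ _ h] := AP j; apply/h => //; exact: (AU j).
have xiR := star_U_Rn (AU 0%N).
have xix : infclose ns m xi (ns (vec V x)).
  apply/infcloseP => [//||e' e'0]; first exact: star_vec.
  (* Then j + 1 > 1 / e', that is d j < e'. *)
  pose j := Num.truncn e'^-1.
  apply: (snear_le xiR (star_vec _ _)) (xiE j).1.
  rewrite /d -[leRHS]invrK lef_pV2 ?posrE ?invr_gt0//.
  exact/ltW/truncnS_gt.
have nxi : nes ns U xi by split; [exact: (AU 0%N)|exists x].
have nx := nes_vec ns Ux.
have [_ nw] := xiE 0%N; apply: nw.
exact: (infcloseP (wns _ nxi).1 (wns _ nx).1).1 (wc _ _ nxi nx xix) e e0.
Qed.

Section Filter.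
Context (k : option nat) (w : W) (wk : elem w (ns (Ck_code V n U k))).

(** A is a set of total maps, a code sees only restrictions to U. Requiring A of every h' that
    agrees with h on U makes membership depend on the graph alone. *)
Definition ext_code (A : set ('rV[R]_m -> 'rV[R]_n)) : V :=
  set_code V U [set h | Ck_on U k h /\ forall h', eq_on U h h' -> A h'].

(* The standard sets of C^k maps whose star contains [w]. *)
Definition internal_filter : set_system ('rV[R]_m -> 'rV[R]_n) :=
  [set A | elem w (ns (ext_code A))].

Lemma elem_ext_code A f : Ck_on U k f ->
  elem (graph V U f) (ext_code A) <-> forall h, eq_on U f h -> A h.
Proof.
move=> fk; rewrite elem_set_code; split=> [[g [gk gA] /eq_graph fg] h fh|fA].
  by apply: gA => x Ux; rewrite -fg// fh.
by exists f.
Qed.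

Lemma internal_filter_Ck : internal_filter (Ck_on U k).
Proof.
apply: (@star_subset _ _ _ _ ns _ _ _ w wk) => _ /elem_Ck_code[f fk ->].
by apply/elem_ext_code => // h fh; exact: Ck_on_eq_on fk.
Qed.

Lemma internal_filter_proper : ProperFilter internal_filter.
Proof.
split; last split.
- move=> F0; have : exists c, elem c (ns (ext_code set0)) by exists w.
  have : ~ exists c, elem c (ext_code set0).
    by move=> [c /elem_set_code[f [_ fA] _]]; exact: (fA f).
  (* The body is false, so the formula says that its bounding set is empty. *)
  have := (xtransfer ns (XAll 1 0 (XNot (XEq 1 1))) (env (Rn V n) [:: ext_code set0])).1.
  move=> /= h n0 [c c0]; apply: (h _ c c0 erefl) => d d0 _.
  by apply: n0; exists d.
- apply: (@star_subset _ _ _ _ ns _ _ _ w wk) => _ /elem_Ck_code[f fk ->].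
  exact/elem_ext_code.
- move=> A B wA wB; apply: ((xtransfer ns (XAll 3 0 (XImp (XMem 3 1) (XMem 3 2)))
    (env (Rn V n) [:: ext_code A; ext_code B; ext_code (A `&` B)])).1 _ w wA wB) => /=.
  move=> _ /elem_set_code[f [fk fA] ->].
  by rewrite !elem_ext_code// => fB h fh; split; [exact: fA|exact: fB].
- move=> A B AB; apply: star_subset => _ /elem_set_code[f [fk fA] ->].
  by apply/elem_ext_code => // h /fA/AB.
Qed.

Lemma internal_filter_cvg (a : mindex m) x (y : 'rV[R]_n) (e : R) : le_order (mlength a) k -> U x ->
  snear n e (app (ipartial ns n U a w) (ns (vec V x))) (ns (vec V y)) ->
  internal_filter [set h | `|mpartial a h x - y| < e].
Proof.
move=> ak Ux near_y; have [wg gmap] := ipartialP hU ak wk.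
have xU := star_vec_U ns Ux.
have near_u u : elem u (ns (Rn V n)) ->
    elem (opair (ns (vec V x)) u) (ipartial ns n U a w) ->
    snear n e u (ns (vec V y)).
  by move=> _ /(isfun_app _ (internal_map gmap) xU) ->.
apply: ((xtransfer ns (XAll 8 0 (XAll 9 1 (XImp (XPMem 8 9 2)
    (XImp (XAll 10 4 (XImp (XPMem 3 10 9) (XPMem 10 5 6))) (XMem 8 7)))))
  (env (Rn V n) [:: Ck_code V n U k; map_code V n U; mpartial_code V n U a; vec V x;
    Rn V n; vec V y; near_code V n e; ext_code [set h | `|mpartial a h x - y| < e]])).1
  _ w wk _ gmap wg near_u) => /=.
move=> _ /elem_Ck_code[f fk ->] g' _; rewrite /upd /env /=.
move=> /(elem_mpartial_code_opair hU _ (Ck_on_mlength ak fk)) -> fu.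
apply/elem_ext_code => // h fh /=; rewrite -(mpartial_eq_on hU _ fh Ux).
apply/(elem_near_code V); apply: fu; last by apply/elem_graph_opair.
by apply/elem_Rn; exists (mpartial a f x).
Qed.

Lemma internal_filter_equicontinuous (a : mindex m) x (d e : R) :
  le_order (mlength a) k -> U x ->
  (forall xi, elem xi sU -> snear m d xi (ns (vec V x)) ->
    snear n e (app (ipartial ns n U a w) xi)
      (app (ipartial ns n U a w) (ns (vec V x)))) ->
  internal_filter [set h | forall y, U y -> `|y - x| < d ->
    `|mpartial a h y - mpartial a h x| < e].
Proof.
move=> ak Ux near_x; have [wg gmap] := ipartialP hU ak wk.
have xU := star_vec_U ns Ux; have gf := internal_map gmap.
have near_u xi : elem xi sU -> forall u, elem u (ns (Rn V n)) ->
    forall v, elem v (ns (Rn V n)) -> snear m d xi (ns (vec V x)) ->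
    elem (opair xi u) (ipartial ns n U a w) ->
    elem (opair (ns (vec V x)) v) (ipartial ns n U a w) -> snear n e u v.
  move=> xiU u _ v _ xix /(isfun_app _ gf xiU) -> /(isfun_app _ gf xU) ->.
  exact: near_x.
apply: ((xtransfer ns (XAll 9 0 (XAll 10 1 (XImp (XPMem 9 10 2)
    (XImp (XAll 11 3 (XAll 12 4 (XAll 13 4 (XImp (XPMem 11 7 5)
      (XImp (XPMem 11 12 10) (XImp (XPMem 7 13 10) (XPMem 12 13 6)))))))
     (XMem 9 8)))))
  (env (Rn V n) [:: Ck_code V n U k; map_code V n U; mpartial_code V n U a;
    subset_code V U; Rn V n; near_code V m d; near_code V n e; vec V x;
    ext_code [set h | forall y, U y -> `|y - x| < d ->
      `|mpartial a h y - mpartial a h x| < e]])).1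
  _ w wk _ gmap wg near_u) => /=.
move=> _ /elem_Ck_code[f fk ->] g' _; rewrite /upd /env /=.
move=> /(elem_mpartial_code_opair hU _ (Ck_on_mlength ak fk)) -> fu.
apply/elem_ext_code => // h fh y Uy yx.
rewrite -(mpartial_eq_on hU _ fh Ux) -(mpartial_eq_on hU _ fh Uy).
apply/(elem_near_code V); apply: (fu (vec V y)).
- by apply/elem_subset_code; exists y.
- by apply/elem_Rn; exists (mpartial a f y).
- by apply/elem_Rn; exists (mpartial a f x).
- exact/elem_near_code.
- by apply/elem_graph_opair.
- by apply/elem_graph_opair.
Qed.

End Filter.

(** Apply [filter_limit_Ck] to the standard parts of all derivatives: closeness to the standard part
    gives convergence, the modulus from [SC0_modulus] gives equicontinuity. *)
Lemma SC_standard_part k w : saturated ns nat -> SC ns n U k w ->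
  Ck_on U k (st_map ns m n w) /\
  forall a, le_order (mlength a) k ->
    eq_on U (mpartial a (st_map ns m n w)) (st_map ns m n (ipartial ns n U a w)).
Proof.
move=> sat [wk wS].
have FF := internal_filter_proper wk.
have [||] := filter_limit_Ck hU (v := fun a => st_map ns m n (ipartial ns n U a w))
  (internal_filter_Ck wk).
- move=> a ak x Ux e e0; apply: (internal_filter_cvg wk ak Ux).
  have [_ gmap] := ipartialP hU ak wk.
  have [wns _] := wS a ak; have wx := wns _ (nes_vec ns Ux).
  exact: (infcloseP wx.1 (star_vec _ _)).1 (infclose_st wx) e e0.
- move=> a ak x Ux e e0; have [_ gmap] := ipartialP hU ak wk.
  have [d d0 wd] := SC0_modulus sat (wS a ak) gmap Ux e0.
  by exists d => //; exact: internal_filter_equicontinuous.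
by rewrite (ipartial0 hU wk).
Qed.

Lemma SC_app_vec k w (a : mindex m) xi x : SC ns n U k w -> le_order (mlength a) k ->
  U x -> nes ns U xi -> infclose ns m xi (ns (vec V x)) ->
  infclose ns n (app (ipartial ns n U a w) xi)
    (ns (vec V (st_map ns m n (ipartial ns n U a w) x))).
Proof.
move=> [wk wS] ak Ux nxi xix; have [wns wc] := wS a ak.
have nx := nes_vec ns Ux; have wx := wns _ nx.
apply: (infclose_trans (b := app (ipartial ns n U a w) (ns (vec V x)))).
- by case: (wns _ nxi).
- by case: wx.
- exact: star_vec.
- exact: wc.
- exact: infclose_st.
Qed.

(** For each e the standard modulus d of f at x transfers, and an infinitesimal distance is below
    every such d. *)
Lemma continuous_app_vec f xi x : {within U, continuous f} -> U x ->
  elem xi sU -> infclose ns m xi (ns (vec V x)) ->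
  infclose ns n (app (ns (graph V U f)) xi) (ns (vec V (f x))).
Proof.
move=> /(continuous_openP hU) fc Ux xiU xix.
have xiR := star_U_Rn xiU.
apply/infcloseP.
- exact: internal_map_val (star_graph_map _ _ _) xiU.
- exact: star_vec.
move=> e e0.
have /cvgrPdist_lt/(_ e e0)/nbhs_ballP[d /= d0 fd] := fc x Ux.
have xid : snear m d xi (ns (vec V x)).
  exact: (infcloseP xiR (star_vec _ _)).1 xix d d0.
move: xi xiU xid {xix xiR}.
have H : forall xi, elem xi sU -> snear m d xi (ns (vec V x)) ->
    forall u, elem u (ns (Rn V n)) -> elem (opair xi u) (ns (graph V U f)) ->
    snear n e u (ns (vec V (f x))).
  apply: (xtransfer ns (XAll 7 0 (XImp (XPMem 7 1 2) (XAll 8 3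
      (XImp (XPMem 7 8 4) (XPMem 8 5 6)))))
    (env (Rn V n) [:: subset_code V U; vec V x; near_code V m d; Rn V n; graph V U f;
      vec V (f x); near_code V n e])).1 => /=.
  move=> _ /elem_subset_code[y Uy ->]; rewrite elem_near_code => yx.
  move=> u _ /elem_graph_opair[_ ->]; apply/elem_near_code.
  by rewrite distrC; apply: fd; rewrite -ball_normE /ball_ /= distrC.
move=> xi xiU xid.
have [h1 h2] := isfun_appP (internal_map (star_graph_map ns U f)) xiU.
exact: (H xi xiU xid _ h2 h1).
Qed.

End InternalMaps.

(** * Uniqueness of standard parts and the three statements *)

Lemma infclose_vec_eq (R : realType) (Y : Type) (V : superstructure R)
    (W : superstructure Y) (ns : nonstandard_extension V W) n (y z : 'rV[R]_n) :
  infclose ns n (ns (vec V y)) (ns (vec V z)) -> y = z.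
Proof.
move=> yz; apply/eqP; rewrite -subr_eq0 -normr_le0.
apply/ler_addgt0Pl => e e0; rewrite addr0; apply/ltW/(elem_near_code V).
have := (infcloseP (star_vec ns y) (star_vec ns z)).1 yz e e0.
exact: (xtransfer ns (XPMem 0 1 2) (env (Rn V n) [:: vec V y; vec V z; near_code V n e])).2.
Qed.

Theorem theorem9p1 (R : realType) (Y : Type)
    (V : superstructure R) (W : superstructure Y)
    (ns : nonstandard_extension V W) (hns : saturated ns nat)
    (m n : nat) (U : set 'rV[R]_m) (hU : open U) (k : option nat) :
  (* (1) *)
  (forall f : W, SC ns n U k f ->
     st_map_exists ns n U f /\
     Ck_on U k (st_map ns m n f) /\
     forall a : mindex m, le_order (mlength a) k ->
       st_map_exists ns n U (ipartial ns n U a f) /\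
       forall x, U x ->
         st_map ns m n (ipartial ns n U a f) x = mpartial a (st_map ns m n f) x) /\
  (* (2) *)
  (forall f g : W, SC ns n U k f -> SC ns n U k g ->
     (forall xi, nes ns U xi -> infclose ns n (app f xi) (app g xi)) ->
     forall a : mindex m, le_order (mlength a) k ->
     forall xi, nes ns U xi ->
       infclose ns n (app (ipartial ns n U a f) xi) (app (ipartial ns n U a g) xi)) /\
  (* (3) *)
  (forall f : W, SC ns n U k f ->
     forall a : mindex m, le_order (mlength a) k ->
     forall xi, nes ns U xi ->
       infclose ns n (app (ipartial ns n U a f) xi)
         (app (ipartial ns n U a (ns (graph V U (st_map ns m n f)))) xi)).
Proof.
have st_map_eq (a : mindex m) f : SC ns n U k f -> le_order (mlength a) k ->
    eq_on U (st_map ns m n (ipartial ns n U a f)) (mpartial a (st_map ns m n f)).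
  by move=> fk ak; apply/eq_on_sym; exact: (SC_standard_part hU hns fk).2.
have SC_Rn (a : mindex m) f xi : SC ns n U k f -> le_order (mlength a) k ->
    nes ns U xi -> elem (app (ipartial ns n U a f) xi) (ns (Rn V n)).
  by move=> [_ fS] ak nxi; have [wns _] := fS a ak; case: (wns _ nxi).
have SC_app a f xi x : SC ns n U k f -> le_order (mlength a) k -> U x ->
    nes ns U xi -> infclose ns m xi (ns (vec V x)) ->
    infclose ns n (app (ipartial ns n U a f) xi)
      (ns (vec V (mpartial a (st_map ns m n f) x))).
  move=> fk ak Ux nxi xix; rewrite -(st_map_eq a f fk ak x Ux).
  exact: SC_app_vec fk ak Ux nxi xix.
have le0 : le_order (mlength ([ffun=> 0%N] : mindex m)) k.
  by rewrite mlength0; case: (k).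
split; [|split].
- move=> f fk; have [fC fS] := fk; split; [|split].
  + move=> x Ux; have [wns _] := fS _ le0.
    by have := wns _ (nes_vec ns Ux); rewrite (ipartial0 hU fC).
  + exact: (SC_standard_part hU hns fk).1.
  + move=> a ak; split; last exact: st_map_eq.
    by move=> x Ux; have [wns _] := fS a ak; exact: wns _ (nes_vec ns Ux).
- move=> f g fk gk fg a ak xi nxi; have [_ [x Ux xix]] := nxi.
  apply: (infclose_trans (SC_Rn a f xi fk ak nxi) (star_vec ns _)
    (SC_Rn a g xi gk ak nxi) (SC_app a f xi x fk ak Ux nxi xix)).
  (* Closeness is assumed for values only. It forces equal standard parts, whose derivatives
     therefore agree, and both internal derivatives at xi are close to that common value at x. *)
  have fg_eq : eq_on U (st_map ns m n f) (st_map ns m n g).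
    move=> y Uy; have ny := nes_vec ns Uy.
    have fz := SC_Rn _ f _ fk le0 ny; have gz := SC_Rn _ g _ gk le0 ny.
    have fy : nearstandard ns n (app f (ns (vec V y))).
      have [wns _] := fk.2 _ le0; have := wns _ ny.
      by rewrite (ipartial0 hU fk.1).
    have gy : nearstandard ns n (app g (ns (vec V y))).
      have [wns _] := gk.2 _ le0; have := wns _ ny.
      by rewrite (ipartial0 hU gk.1).
    apply: (@infclose_vec_eq _ _ _ _ ns); rewrite /st_map.
    apply: (infclose_trans (star_vec ns _) gy.1 (star_vec ns _) _ (infclose_st gy)).
    apply: (infclose_trans (star_vec ns _) fy.1 gy.1 _ (fg _ ny)).
    exact: infclose_sym fy.1 (star_vec ns _) (infclose_st fy).
  rewrite (mpartial_eq_on hU a fg_eq Ux).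
  apply: (infclose_sym (SC_Rn a g xi gk ak nxi) (star_vec ns _)).
  exact: SC_app.
- move=> f fk a ak xi nxi; have [xiU [x Ux xix]] := nxi.
  have [Fk _] := SC_standard_part hU hns fk.
  (* By (1) the standard part is a standard C^k map, so its derivative commutes with the star and is
     continuous at x. *)
  rewrite (ipartial_star_graph ns hU (Ck_on_mlength ak Fk)).
  apply: (infclose_trans (SC_Rn a f xi fk ak nxi) (star_vec ns _) _
    (SC_app a f xi x fk ak Ux nxi xix)).
    exact: internal_map_val (star_graph_map _ _ _) xiU.
  apply: infclose_sym; [|exact: star_vec|].
    exact: internal_map_val (star_graph_map _ _ _) xiU.
  apply: (continuous_app_vec hU) => //.
  by apply: mpartial_continuous; apply: Fk.
Qed.
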